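(* Let $1\le s\le r<\infty$, let $X$ be a complex Banach space, and let $m,N\in\mathbb{N}$. For every family $(x_\alpha)_{\alpha\in\mathbb{N}_0^N,\,|\alpha|=m}\subset X$ we have $$\Big(\int_{\mathbb{T}^N}\Big\|\sum_{|\alpha|=m}x_\alpha z^\alpha\Big\|^rdz\Big)^{1/r}\le\Big(\frac rs\Big)^{\frac m2}\Big(\int_{\mathbb{T}^N}\Big\|\sum_{|\alpha|=m}x_\alpha z^\alpha\Big\|^sdz\Big)^{1/s}.$$
   Context: $\mathbb{T}=\{z\in\mathbb{C}:|z|=1\}$ and $\mathbb{T}^N$ carries the product of the normalized Lebesgue measure on $\mathbb{T}$, denoted $dz$. For $\alpha\in\mathbb{N}_0^N$, $|\alpha|=\alpha_1+\cdots+\alpha_N$ and $z^\alpha=z_1^{\alpha_1}\cdots z_N^{\alpha_N}$. *)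

(* Defs.v *)
From HB Require Import structures.
From mathcomp Require Import all_boot all_order all_algebra.
From mathcomp Require Import complex.
From mathcomp Require Import all_classical all_reals all_analysis.
From mathcomp Require Import measurable_realfun.
Import Order.TTheory GRing.Theory Num.Theory.
Import numFieldNormedType.Exports.

Set Implicit Arguments.
Unset Strict Implicit.
Unset Printing Implicit Defensive.

Local Open Scope classical_set_scope.
Local Open Scope ring_scope.
Local Open Scope complex_scope.

(* The norm of a complex normed module takes its values in [R[i]] (on the
   nonnegative real axis); [rnorm] is the same number as an element of [R]. *)
Definition rnorm {R : realType} {X : normedModType R[i]} (v : X) : R :=
  complex.Re `|v|.

Record circle (R : realType) := Circle {
  circle_val :> R[i];
  _ : `|circle_val| == 1
}.

HB.instance Definition _ (R : realType) := [isSub for @circle_val R].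
HB.instance Definition _ (R : realType) := [Choice of circle R by <:].

Fact circle1_subproof (R : realType) : `|1 : R[i]| == 1.
Proof. by rewrite normr1. Qed.

HB.instance Definition _ (R : realType) :=
  isPointed.Build (circle R) (Circle (circle1_subproof R)).

HB.instance Definition _ (R : realType) :=
  Topological.copy (circle R)
    (initial_topology (@circle_val R : circle R -> R[i]^o)).

HB.instance Definition _ (R : realType) :=
  Measurable.copy (circle R) (g_sigma_algebraType (@open (circle R))).

Fact expi_subproof (R : realType) (t : R) : `|cos t +i* sin t| == 1.
Proof. by rewrite normc_def /= cos2Dsin2 sqrtr1. Qed.

Definition expi {R : realType} (t : measurableTypeR R) : circle R :=
  Circle (expi_subproof t).

Lemma continuous_cos_sin (R : realType) :
  continuous (fun t : R => (cos t +i* sin t : R[i]^o)).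
Proof.
move=> t; apply/cvgrPdist_lt => e e0.
have e0' : 0 < complex.Re e by move: e0; rewrite ltcE => /andP[].
have eE : e = (complex.Re e)%:C.
  by move: e0; case: e {e0'} => a b; rewrite ltcE /= => /andP[/eqP -> _].
have he : 0 < complex.Re e / 2 by rewrite divr_gt0.
have /cvgrPdist_lt /(_ _ he) Hc := @continuous_cos R t.
have /cvgrPdist_lt /(_ _ he) Hs := @continuous_sin R t.
near=> u.
have hc : `|cos t - cos u| < complex.Re e / 2 by near: u.
have hs : `|sin t - sin u| < complex.Re e / 2 by near: u.
rewrite eE.
have -> : (cos t +i* sin t) - (cos u +i* sin u) =
   (cos t - cos u) +i* (sin t - sin u) :> R[i] by [].
rewrite normc_def ltcR /=.
apply: le_lt_trans (_ : _ <= `|cos t - cos u| + `|sin t - sin u|) _; last first.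
  by rewrite (splitr (complex.Re e)) ltrD.
rewrite -(ler_pXn2r (n:=2)) ?nnegrE ?sqrtr_ge0 ?addr_ge0//.
rewrite sqr_sqrtr ?addr_ge0 ?sqr_ge0// [leRHS]sqrrD !real_normK ?num_real//.
by rewrite lerD2r lerDl mulrn_wge0 // mulr_ge0.
Unshelve. all: by end_near. Qed.

Lemma measurable_expi (R : realType) :
  measurable_fun [set: measurableTypeR R] (@expi R).
Proof.
apply: (measurability (@open (circle R))) => //.
move=> _ [_ [B oB <-] <-]; rewrite setTI.
apply: open_measurable.
by move: B oB; apply/continuousP; exact: continuous_cos_sin.
Qed.

HB.instance Definition _ (R : realType) :=
  @isMeasurableFun.Build _ _ _ _ (@expi R) (@measurable_expi R).

Fact pi2_gt0 (R : realType) : 0 < pi *+ 2 :> R.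
Proof. by rewrite pmulrn_lgt0 // pi_gt0. Qed.

(* Normalized Lebesgue measure on the circle: the image of the uniform
   probability measure on [0, 2 pi] under [expi]. *)
Definition circle_prob (R : realType) : probability (circle R) R :=
  distribution (uniform_prob (pi2_gt0 R))
    (expi : {mfun measurableTypeR R >-> circle R}).

Section power_prob.
Context d (T : measurableType d) (R : realType) (P : probability T R).

Definition tuple_cons n (u : T * n.-tuple T) : n.+1.-tuple T :=
  [tuple of u.1 :: u.2].

Lemma measurable_tuple_cons n : measurable_fun setT (@tuple_cons n).
Proof. exact: measurable_cons. Qed.

HB.instance Definition _ n :=
  isMeasurableFun.Build _ _ _ _ (@tuple_cons n) (@measurable_tuple_cons n).

(* The [n]-fold product of [P], on the product sigma-algebra of [n.-tuple T]. *)
Fixpoint power_prob n : probability (n.-tuple T) R :=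
  match n with
  | 0 => \d_([tuple] : 0.-tuple T)
  | n'.+1 => distribution (P \x power_prob n')%E (@tuple_cons n')
  end.
End power_prob.

(* A multi-index of weight [m] has all its entries at most [m], so this finite
   type is the set of all [alpha] in N_0^N with [|alpha| = m]. *)
Definition multiindex (N m : nat) : Type :=
  {a : {ffun 'I_N -> 'I_m.+1} | (\sum_(i < N) a i)%N == m}.

Definition monomial {R : realType} {N m : nat}
    (z : N.-tuple (circle R)) (a : multiindex N m) : R[i] :=
  \prod_(i < N) circle_val (tnth z i) ^+ (sval a i).

Definition homog_poly {R : realType} {X : normedModType R[i]} {N m : nat}
    (x : multiindex N m -> X) (z : N.-tuple (circle R)) : X :=
  \sum_(a : multiindex N m) monomial z a *: x a.

(* Main.v *)
(* Put rho = sqrt(s/r). By homogeneity the claim is that the dilation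
   F |-> F(rho z) is a contraction from L^s to L^r, and by induction on the number
   of variables and Minkowski's integral inequality it suffices to treat one
   variable. There log ||f|| is subharmonic, so that ||f|| may be replaced on the
   circle by exp u with u the real part of a polynomial, and one has to show
     int exp(r u_rho) <= (int exp(s u))^(r/s).
   By the Gibbs variational principle this is dual to the entropy contraction
   Ent(h_rho) <= rho^2 Ent(h) for positive harmonic h = Re G. On the circle of
   radius x the derivative of x d/dx Ent(h_x) is x times the mean of |G'|^2 / Re G,
   which increases with x because |a|^2 / b is jointly convex; this gives the
   contraction with the sharp constant.
   Averages against the Poisson kernel are replaced by positive finite quadratures
   exact on polynomials of bounded degree, so that Jensen's inequality is about
   finite sums and also applies to vector-valued polynomials. *)
Require Import Defs.
From mathcomp Require Import all_boot all_order all_algebra.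
From mathcomp Require Import complex ring lra.
From mathcomp Require Import all_classical all_reals all_analysis.
From mathcomp Require Import measurable_realfun.
Import Order.TTheory GRing.Theory Num.Theory.
Import numFieldNormedType.Exports.

Set Implicit Arguments.
Unset Strict Implicit.
Unset Printing Implicit Defensive.

Local Open Scope classical_set_scope.
Local Open Scope ring_scope.
Local Open Scope complex_scope.

(** The constant of the theorem is rho^(-m), because dilation by rho multiplies every monomial of
    degree m by rho^m. The value rho^2 = s/r is forced by a cancellation. Take h = exp(r u_rho) with
    mean M, and let Ent(h) = mean(h ln h) - M ln M. Dilation is self-adjoint, so (s/r) mean(h ln h)
    = mean(h_rho s u). Gibbs bounds this by M ln Z + Ent(h_rho), where Z = mean exp(s u), and the
    contraction bounds Ent(h_rho) by rho^2 Ent(h). With rho^2 = s/r the two terms in mean(h ln h)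
    cancel, and ln M <= (r/s) ln Z remains. The obstacle is that a vector-valued polynomial may
    vanish and its zeros cannot be divided out, so neither its logarithm nor its powers are
    available. This is why the norm is majorized by exp u before any analysis is done. Likewise
    exp(r u_rho) is not itself the real part of a polynomial on the circle; it is replaced by one
    that is, at the price of a factor tending to 1. *)

Notation Re := (@complex.Re _).
Notation Im := (@complex.Im _).
Notation normc := (@Normc.normc _).

(** * Poisson quadrature on the circle *)

Section complex_numbers.
Context {R : realType}.
Implicit Types (z w : R[i]) (t : R).

Lemma ReD z w : Re (z + w) = Re z + Re w. Proof. by case: z w => ? ? []. Qed.
Lemma ImD z w : Im (z + w) = Im z + Im w. Proof. by case: z w => ? ? []. Qed.
Lemma ReN z : Re (- z) = - Re z. Proof. by case: z. Qed.
Lemma ImN z : Im (- z) = - Im z. Proof. by case: z. Qed.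
Lemma ReB z w : Re (z - w) = Re z - Re w. Proof. by rewrite ReD ReN. Qed.
Lemma ReM z w : Re (z * w) = Re z * Re w - Im z * Im w.
Proof. by case: z w => ? ? []. Qed.
Lemma ImM z w : Im (z * w) = Re z * Im w + Im z * Re w.
Proof. by case: z w => ? ? []. Qed.
Lemma ReZ (a : R) z : Re (a%:C * z) = a * Re z.
Proof. by rewrite ReM mul0r subr0. Qed.
Lemma Re_sum (I : finType) (F : I -> R[i]) : Re (\sum_i F i) = \sum_i Re (F i).
Proof. by elim/big_rec2: _ => [|i x y _ <-]; rewrite ?ReD. Qed.
Lemma Im_sum (I : finType) (F : I -> R[i]) : Im (\sum_i F i) = \sum_i Im (F i).
Proof. by elim/big_rec2: _ => [|i x y _ <-]; rewrite ?ImD. Qed.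
Lemma ReC (a : R) : Re a%:C = a. Proof. by []. Qed.

Lemma normc_sqrt z : normc z = Num.sqrt (Re z ^+ 2 + Im z ^+ 2).
Proof. by case: z. Qed.
Lemma normc_normr z : `|z| = (normc z)%:C. Proof. by case: z. Qed.
Lemma normc_sqr z : normc z ^+ 2 = Re z ^+ 2 + Im z ^+ 2.
Proof. by rewrite normc_sqrt sqr_sqrtr// addr_ge0// sqr_ge0. Qed.
Lemma normc_ge0 z : 0 <= normc z. Proof. by rewrite normc_sqrt sqrtr_ge0. Qed.
Lemma normcX z n : normc (z ^+ n) = normc z ^+ n.
Proof.
by elim: n => [|n IHn]; rewrite ?expr0 ?Normc.normc1// !exprS Normc.normcM IHn.
Qed.
Lemma normcC (a : R) : normc a%:C = `|a|.
Proof. by rewrite normc_sqrt /= expr0n addr0 sqrtr_sqr. Qed.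
Lemma normc_triangle z w : normc (z + w) <= normc z + normc w.
Proof. by rewrite -lecR rmorphD -!normc_normr ler_normD. Qed.
Lemma le_Re_normc z : `|Re z| <= normc z.
Proof. by rewrite -lecR -normc_normr normc_ge_Re. Qed.
Definition cis (t : R) : R[i] := cos t +i* sin t.

Lemma cis0 : cis 0 = 1. Proof. by rewrite /cis cos0 sin0. Qed.
Lemma cisD t u : cis (t + u) = cis t * cis u.
Proof. by rewrite /cis cosD sinD; congr (_ +i* _); rewrite addrC mulrC [X in _ + X]mulrC. Qed.
Lemma cisX t n : cis t ^+ n = cis (t *+ n).
Proof. by elim: n => [|n IHn]; rewrite ?expr0 ?cis0// exprS IHn -cisD mulrS. Qed.
Lemma normc_cis t : normc (cis t) = 1.
Proof. by rewrite normc_sqrt /= cos2Dsin2 sqrtr1. Qed.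
Lemma cis_neq0 t : cis t != 0.
Proof.
apply/eqP => /(congr1 normc); rewrite normc_cis Normc.normc0.
by move/eqP; rewrite oner_eq0.
Qed.
Lemma cisN t : cis t * cis (- t) = 1.
Proof. by rewrite -cisD subrr cis0. Qed.
Lemma cis2pi : cis (pi *+ 2) = 1.
Proof. by rewrite /cis cos2pi sin2pi. Qed.
Lemma cis_periodic t : cis (t + pi *+ 2) = cis t.
Proof. by rewrite cisD cis2pi mulr1. Qed.

Lemma cis_eq1 t : 0 < t < pi *+ 2 -> cis t != 1.
Proof.
move=> /andP[t0 t2]; rewrite /cis; apply/eqP => -[c1 s0].
have : 0 < sin (t / 2) by apply: sin_gt0_pi; rewrite divr_gt0//= ltr_pdivrMr// mulr_natr.
have : cos t = 1 - 2 * sin (t / 2) ^+ 2.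
  rewrite {1}(splitr t) cosD -!expr2 cos2sin2; ring.
rewrite c1 => /eqP; rewrite eq_sym subr_eq addrC -subr_eq subrr eq_sym mulf_eq0.
by rewrite pnatr_eq0/= sqrf_eq0 => /eqP ->; rewrite ltxx.
Qed.

Definition unity_arg n (k : nat) : R := pi *+ 2 * (k%:R / n%:R).

Lemma sum_unity n (m : nat) : (0 < m < n)%N ->
  \sum_(k < n) cis (unity_arg n k) ^+ m = 0.
Proof.
move=> /andP[m0 mn]; have n0 : (0 < n)%N by exact: leq_trans mn.
have nR : n%:R != 0 :> R by rewrite pnatr_eq0 -lt0n.
pose q := cis (pi *+ 2 * (m%:R / n%:R)).
have q1 : q != 1.
  apply: cis_eq1; rewrite mulr_gt0 ?pi2_gt0 ?divr_gt0 ?ltr0n//=.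
  by rewrite gtr_pMr ?pi2_gt0// ltr_pdivrMr ?ltr0n// mul1r ltr_nat.
under eq_bigr => k _.
  have -> : cis (unity_arg n k) ^+ m = q ^+ k.
    rewrite !cisX /unity_arg; congr cis.
    by rewrite -[LHS]mulr_natr -[RHS]mulr_natr; ring.
  over.
apply/eqP; have: (q - 1) * \sum_(k < n) q ^+ k == 0.
  rewrite -subrX1 cisX.
  have -> : pi *+ 2 * (m%:R / n%:R) *+ n = pi *+ 2 *+ m :> R.
    by rewrite -[LHS]mulr_natr -[RHS]mulr_natr; field.
  by rewrite -cisX cis2pi expr1n subrr.
by rewrite mulf_eq0 subr_eq0 (negbTE q1).
Qed.

(* The Poisson kernel truncated at degree [L]. *)
Definition tpoisson (rho : R) (L : nat) (w : R[i]) : R :=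
  2 * Re (\sum_(l < L.+1) (rho%:C * w) ^+ l) - 1.

(* |1 - rho w|^2 times the truncated kernel is
   1 - rho^2 - 2 Re ((1 - rho w^-1) (rho w)^(L+1)) on the unit circle. *)
Lemma tpoisson_ge0 rho L t : 0 <= rho < 1 -> 2 * rho ^+ L.+1 <= 1 - rho ->
  0 <= tpoisson rho L (cis t).
Proof.
move=> /andP[rho0 rho1] hL; set w := cis t.
pose p := (1 - rho%:C * w); pose p' := (1 - rho%:C * cis (- t)).
have pp' : p * p' = (1 - 2 * rho * cos t + rho ^+ 2)%:C.
  have -> : p * p' = 1 - rho%:C * (w + cis (- t)) + rho%:C ^+ 2 * (w * cis (- t)).
    by rewrite /p /p'; ring.
  rewrite cisN /w /cis cosN sinN; apply/eqP; rewrite eq_complex /=.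
  by apply/andP; split; apply/eqP; ring.
have m0 : 0 < 1 - 2 * rho * cos t + rho ^+ 2.
  have := cos_le1 t; have : 0 < (1 - rho) ^+ 2 by rewrite exprn_gt0// subr_gt0.
  nra.
rewrite -(pmulr_rge0 _ m0).
have pS : p * \sum_(l < L.+1) (rho%:C * w) ^+ l = 1 - (rho%:C * w) ^+ L.+1.
  by rewrite -[RHS]opprB subrX1 -mulNr opprB.
rewrite /tpoisson mulrBr mulr1 mulrCA -ReZ -pp' mulrAC pS.
have rE : Re ((1 - (rho%:C * w) ^+ L.+1) * p') =
    1 - rho * cos t - Re ((rho%:C * w) ^+ L.+1 * p').
  rewrite mulrBl mul1r ReB; congr (_ - _).
  by rewrite /p' ReB ReZ /= cosN.
rewrite rE.
have : Re ((rho%:C * w) ^+ L.+1 * p') <= rho ^+ L.+1 * (1 + rho).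
  rewrite (le_trans (ler_norm _))// (le_trans (le_Re_normc _))//.
  rewrite Normc.normcM normcX Normc.normcM normc_cis mulr1 normcC ger0_norm//.
  rewrite ler_wpM2l ?exprn_ge0// (le_trans (normc_triangle _ _))//.
  rewrite Normc.normc1 lerD2l -mulNr Normc.normcM normc_cis mulr1 -rmorphN normcC.
  by rewrite normrN ger0_norm.
nra.
Qed.

Lemma tpoisson_sum rho L t : (tpoisson rho L (cis t))%:C =
  \sum_(l < L.+1) rho%:C ^+ l * (cis t ^+ l + cis (- t) ^+ l) - 1.
Proof.
rewrite /tpoisson rmorphB rmorphM Re_sum rmorph_sum mulr_sumr /=; congr (_ - 1).
apply: eq_bigr => l _; rewrite exprMn -rmorphXn ReZ rmorphM mulrCA; congr (_ * _).
rewrite !cisX /cis mulNrn cosN sinN; apply/eqP; rewrite eq_complex /=.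
by apply/andP; split; apply/eqP; ring.
Qed.

(** The kernel times the [j]-th power has frequencies between j - L and j + L, all below [n] in
    absolute value, so sampling at [n] equally spaced points only sees frequency 0. What survives is
    the kernel's coefficient at frequency -j, which is rho^j. *)
Lemma tpoisson_moment rho L n j t : (j <= L)%N -> (L + j < n)%N ->
  \sum_(k < n) (tpoisson rho L (cis (t + unity_arg n k)))%:C *
    cis (t + unity_arg n k) ^+ j = n%:R * rho%:C ^+ j.
Proof.
move=> jL Ljn; have n0 : (0 < n)%N by exact: leq_trans Ljn.
have sumE (m : nat) : (m < n)%N ->
    \sum_(k < n) cis (t + unity_arg n k) ^+ m = n%:R * (m == 0)%:R.
  move=> mn; have [->|m0] := eqVneq m 0%N.
    by rewrite mulr1; under eq_bigr do rewrite expr0; rewrite sumr_const card_ord.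
  under eq_bigr do rewrite cisD exprMn.
  by rewrite -mulr_sumr sum_unity ?mulr0// lt0n m0.
have sumN (m : nat) : (m < n)%N ->
    \sum_(k < n) cis (- (t + unity_arg n k)) ^+ m = n%:R * (m == 0)%:R.
  move=> mn; have [->|m0] := eqVneq m 0%N.
    by rewrite mulr1; under eq_bigr do rewrite expr0; rewrite sumr_const card_ord.
  rewrite mulr0; under eq_bigr => k _.
    rewrite opprD cisD exprMn.
    (* At an n-th root of unity the inverse of the m-th power is the power n - m, so negative
       frequencies reduce to [sum_unity]. *)
    have -> : cis (- unity_arg n k) ^+ m = cis (unity_arg n k) ^+ (n - m).
      apply: (mulfI (expf_neq0 m (cis_neq0 (unity_arg n k)))).
      rewrite -exprMn cisN expr1n -exprD subnKC 1?ltnW// cisX.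
      have -> : unity_arg n k *+ n = pi *+ 2 *+ k :> R.
        rewrite /unity_arg -[LHS]mulr_natr -[RHS]mulr_natr; field.
        by rewrite pnatr_eq0 -lt0n.
      by rewrite -cisX cis2pi expr1n.
    over.
  by rewrite -mulr_sumr sum_unity ?mulr0// subn_gt0 mn /= ltn_subrL n0 lt0n m0.
under eq_bigr do rewrite tpoisson_sum mulrBl mul1r mulr_suml.
rewrite sumrB sumE; last by rewrite (leq_ltn_trans _ Ljn)// leq_addl.
rewrite exchange_big /=.
have lE (l : 'I_L.+1) : \sum_(k < n) rho%:C ^+ l * (cis (t + unity_arg n k) ^+ l
      + cis (- (t + unity_arg n k)) ^+ l) * cis (t + unity_arg n k) ^+ j
    = rho%:C ^+ l * (n%:R * (l + j == 0)%N%:R + n%:R * (l == j :> nat)%:R).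
  under eq_bigr do rewrite -mulrA mulrDl -exprD.
  rewrite -mulr_sumr big_split /= sumE; last first.
    by rewrite (leq_ltn_trans _ Ljn)// leq_add2r -ltnS.
  congr (_ * (_ + _)).
  have [lj|jl] := leqP l j.
    transitivity (\sum_(k < n) cis (t + unity_arg n k) ^+ (j - l)).
      apply: eq_bigr => k _; rewrite -[X in _ * _ ^+ X](subnKC lj) exprD mulrA -exprMn.
      by rewrite [cis (- _) * _]mulrC cisN expr1n mul1r.
    rewrite sumE; first by rewrite subn_eq0 eqn_leq lj.
    by rewrite (leq_ltn_trans (leq_subr _ _))// (leq_ltn_trans _ Ljn)// leq_addl.
  transitivity (\sum_(k < n) cis (- (t + unity_arg n k)) ^+ (l - j)).
    apply: eq_bigr => k _; rewrite -[X in _ ^+ X * _](subnKC (ltnW jl)) exprD mulrAC -exprMn.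
    by rewrite [cis (- _) * _]mulrC cisN expr1n mul1r.
  rewrite sumN; first by rewrite subn_eq0 eqn_leq [(l <= j)%N]leqNgt jl.
  rewrite (leq_ltn_trans (leq_subr _ _))// (leq_ltn_trans _ Ljn)//.
  by rewrite (leq_trans _ (leq_addr _ _))// -ltnS.
under eq_bigr do rewrite lE mulrDr.
(* [tpoisson_sum] counts the constant mode twice; the contribution of l = 0 isolated here cancels
   the subtracted 1. *)
rewrite big_split /= (bigD1 ord0)//= expr0 mul1r big1 ?addr0; last first.
  move=> l l0; have -> : (l + j == 0)%N = false.
    rewrite addn_eq0; apply/negbTE; rewrite negb_and; apply/orP; left.
    by apply: contra l0 => /eqP l0; apply/eqP/val_inj.
  by rewrite !mulr0.
rewrite (bigD1 (Ordinal (jL : (j < L.+1)%N)))//= eqxx mulr1 big1 ?addr0; last first.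
  move=> l lj; have -> : (l == j :> nat) = false by apply: negbTE.
  by rewrite !mulr0.
by rewrite add0n addrAC subrr add0r mulrC.
Qed.

(** The second condition is the hypothesis of [tpoisson_ge0]: it keeps the truncation term 2
    rho^(L+1) (1 + rho) below 1 - rho^2. *)
Lemma exists_degree (rho : R) (d : nat) : 0 <= rho < 1 ->
  exists2 L, (d <= L)%N & 2 * rho ^+ L.+1 <= 1 - rho.
Proof.
move=> /andP[rho0 rho1].
have h : 0 < (1 - rho) / 2 by rewrite divr_gt0// subr_gt0.
have /cvgr0_norm_lt /(_ _ h) [N _ HN] : rho ^+ n @[n --> \oo] --> (0 : R).
  by apply: cvg_expr; rewrite ger0_norm.
exists (maxn d N); first exact: leq_maxl.
have /= := HN (maxn d N).+1 (leq_trans (leq_maxr d N) (leqnSn _)).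
rewrite ger0_norm ?exprn_ge0// ltr_pdivlMr// => /ltW.
by rewrite mulrC.
Qed.

(** A finite stand-in for the Poisson kernel at radius rho: averaging p(w cis(theta_k)) with weights
    kappa_k gives p(rho w) for every polynomial p of degree at most [d]. The case j = 0 makes the
    nonnegative weights a probability. *)
Definition is_quadrature (rho : R) (d n : nat) (kappa theta : 'I_n -> R) :=
  (forall k, 0 <= kappa k) /\
  (forall j, (j <= d)%N ->
    \sum_(k < n) (kappa k)%:C * cis (theta k) ^+ j = rho%:C ^+ j).

Lemma exists_quadrature (rho : R) (d : nat) : 0 <= rho <= 1 ->
  exists n (kappa theta : 'I_n -> R), is_quadrature rho d kappa theta.
Proof.
move=> /andP[rho0]; rewrite le_eqVlt => /predU1P[->|rho1].
  (* At rho = 1 the Poisson kernel degenerates to the point mass at angle 0. *)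
  exists 1%N, (fun=> 1), (fun=> 0); split=> // j _.
  by rewrite big_ord1 cis0 !expr1n mulr1.
have [|L dL hL] := @exists_degree rho d; first by rewrite rho0.
(* With [L + d + 1] nodes, [tpoisson_moment] covers all moments up to [d]. *)
exists (L + d).+1, (fun k => tpoisson rho L (cis (0 + unity_arg (L + d).+1 k)) / (L + d).+1%:R),
  (fun k => 0 + unity_arg (L + d).+1 k); split.
  by move=> k; rewrite divr_ge0// tpoisson_ge0// rho0.
move=> j jd; under eq_bigr do rewrite rmorphM mulrAC.
rewrite -mulr_suml tpoisson_moment ?(leq_trans jd)//; last by rewrite ltnS leq_add2l.
rewrite -[n in n%:R * _]/((L + d).+1) fmorphV rmorph_nat mulrAC divff ?mul1r//.
Qed.

End complex_numbers.

(** * Vector-valued polynomials: maximum principle and exponential majorants *)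

Section vector_polynomials.
Context {R : realType}.

Section rnorm.
Context {X : normedModType R[i]}.
Implicit Types (v w : X) (z : R[i]).

Lemma normr_rnorm v : `|v| = (rnorm v)%:C.
Proof. by rewrite /rnorm RRe_real// ger0_real. Qed.
Lemma rnorm_ge0 v : 0 <= rnorm v.
Proof. by rewrite -lecR -normr_rnorm normr_ge0. Qed.
Lemma rnorm0 : rnorm (0 : X) = 0.
Proof. by rewrite /rnorm normr0. Qed.
Lemma rnormD v w : rnorm (v + w) <= rnorm v + rnorm w.
Proof. by rewrite -lecR -normr_rnorm (le_trans (ler_normD _ _))// !normr_rnorm -rmorphD. Qed.
Lemma rnormB v w : rnorm (v - w) = rnorm (w - v).
Proof. by rewrite /rnorm distrC. Qed.
Lemma rnormZ z v : rnorm (z *: v) = normc z * rnorm v.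
Proof.
by rewrite /rnorm normrZ normc_normr normr_rnorm -rmorphM.
Qed.
Lemma rnorm_sum (I : finType) (F : I -> X) :
  rnorm (\sum_i F i) <= \sum_i rnorm (F i).
Proof.
elim/big_rec2: _ => [|i x y _ le_yx]; first by rewrite rnorm0.
by rewrite (le_trans (rnormD _ _))// lerD2l.
Qed.
Lemma rnorm_dist v w : `|rnorm v - rnorm w| <= rnorm (v - w).
Proof.
rewrite ler_norml; apply/andP; split.
  by rewrite lerNl opprB lerBlDr rnormB -[X in rnorm X <= _](subrK v) rnormD.
by rewrite lerBlDr -[X in rnorm X <= _](subrK w) rnormD.
Qed.
End rnorm.

Section vpoly.
Context {X : normedModType R[i]} {A : finType}.
Implicit Types (e : A -> nat) (y : A -> X).

(** Exponents may repeat over the index type: a polynomial in several variables has this form once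
    all variables but one are frozen, and so does a product of two polynomials. *)
Definition vpoly e y (w : R[i]) : X := \sum_a w ^+ e a *: y a.

Lemma vpoly_quadrature (rho : R) d n (kappa theta : 'I_n -> R) e y w :
  is_quadrature rho d kappa theta -> (forall a, (e a <= d)%N) ->
  vpoly e y (rho%:C * w) =
    \sum_(k < n) (kappa k)%:C *: vpoly e y (w * cis (theta k)).
Proof.
move=> [_ hq] ed; under [RHS]eq_bigr do rewrite scaler_sumr.
rewrite exchange_big; apply: eq_bigr => a _ /=.
under eq_bigr do rewrite scalerA exprMn mulrCA.
by rewrite -scaler_suml -mulr_sumr hq// -exprMn mulrC.
Qed.
End vpoly.

Lemma horner_quadrature (rho : R) d n (kappa theta : 'I_n -> R) (P : {poly R[i]}) w :
  is_quadrature rho d kappa theta -> (size P <= d.+1)%N ->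
  P.[rho%:C * w] = \sum_(k < n) (kappa k)%:C * P.[w * cis (theta k)].
Proof.
move=> [_ hq] sP; rewrite horner_coef.
under [RHS]eq_bigr do rewrite horner_coef mulr_sumr.
rewrite exchange_big; apply: eq_bigr => a _ /=.
under eq_bigr do rewrite exprMn mulrCA [X in _ * X]mulrCA mulrA.
rewrite -mulr_sumr hq ?exprMn; last by rewrite -ltnS (leq_trans _ sP).
by rewrite -mulrA [rho%:C ^+ _ * _]mulrC.
Qed.

Lemma is_quadrature_sum (rho : R) d n (kappa theta : 'I_n -> R) :
  is_quadrature rho d kappa theta -> \sum_(k < n) kappa k = 1.
Proof.
case=> _ /(_ 0%N (leq0n _)); rewrite expr0; under eq_bigr do rewrite expr0 mulr1.
by rewrite -rmorph_sum => /complexI.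
Qed.

(** The scalar factor [q] is kept apart because it will approximate exp(-g). The product is again a
    [vpoly], indexed by pairs, so its value at radius rho is a convex combination of boundary
    values, and the triangle inequality concludes. *)
Lemma maximum_principle (X : normedModType R[i]) (A : finType) (e : A -> nat)
    (y : A -> X) (q : {poly R[i]}) (rho M t : R) : 0 <= rho <= 1 ->
    (forall u, normc q.[cis u] * rnorm (vpoly e y (cis u)) <= M) ->
  normc q.[rho%:C * cis t] * rnorm (vpoly e y (rho%:C * cis t)) <= M.
Proof.
move=> hrho hM.
pose e' (p : 'I_(size q) * A) := (p.1 + e p.2)%N.
pose y' (p : 'I_(size q) * A) := q`_p.1 *: y p.2.
have qf w : vpoly e' y' w = q.[w] *: vpoly e y w.
  rewrite /vpoly horner_coef scaler_suml -[LHS](pair_bigA _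
    (fun i a => w ^+ e' (i, a) *: y' (i, a))) /=.
  apply: eq_bigr => i _; rewrite scaler_sumr; apply: eq_bigr => a _.
  by rewrite !scalerA exprD /= mulrAC [q`_i * _]mulrC.
pose d := \max_p e' p.
have [n [kappa [theta hq]]] := exists_quadrature d hrho.
rewrite -rnormZ -qf (vpoly_quadrature _ _ hq); last by move=> p; exact: leq_bigmax.
rewrite (le_trans (rnorm_sum _))//.
rewrite -[leRHS]mul1r -(is_quadrature_sum hq) mulr_suml ler_sum// => k _.
have [k0 _] := hq.
by rewrite rnormZ normcC ger0_norm// ler_wpM2l// qf rnormZ -cisD hM.
Qed.

Lemma horner_lipschitz (P : {poly R[i]}) (M : R) :
  exists2 K, 0 <= K & forall w z, normc w <= M -> normc z <= M ->
    normc P.[w] <= K /\ normc (P.[w] - P.[z]) <= K * normc (w - z).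
Proof.
elim/poly_ind: P => [|P c [K K0 IH]].
  by exists 0 => // w z _ _; rewrite !horner0 subrr Normc.normc0 mul0r.
have [M0|M0] := ltP M 0.
  by exists 0 => // w z wM; have := normc_ge0 w; lra.
(* [K * M + normc c] bounds the value and [K + K * M] is a Lipschitz constant; their common upper
   bound serves for both. *)
exists (K * M + K + normc c); first by rewrite !addr_ge0 ?mulr_ge0 ?normc_ge0.
move=> w z wM zM; rewrite !hornerE; have [hw hwz] := IH _ _ wM zM; split.
  rewrite (le_trans (normc_triangle _ _))// lerD2r Normc.normcM.
  by rewrite (le_trans (ler_pM (normc_ge0 _) (normc_ge0 _) hw wM))// lerDl.
have -> : P.[w] * w + c - (P.[z] * z + c) =
    P.[w] * (w - z) + (P.[w] - P.[z]) * z by ring.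
rewrite (le_trans (normc_triangle _ _))// !Normc.normcM.
have := ler_wpM2r (normc_ge0 (w - z)) hw.
have := ler_pM (normc_ge0 _) (normc_ge0 _) hwz zM.
have := mulr_ge0 (normc_ge0 c) (normc_ge0 (w - z)).
lra.
Qed.

Lemma vpoly_lipschitz (X : normedModType R[i]) (A : finType) (e : A -> nat)
    (y : A -> X) (M : R) :
  exists2 K, 0 <= K & forall w z, normc w <= M -> normc z <= M ->
    rnorm (vpoly e y w) <= K /\
    rnorm (vpoly e y w - vpoly e y z) <= K * normc (w - z).
Proof.
pose K a := sval (cid2 (horner_lipschitz ('X^(e a)) M)).
have KP a : 0 <= K a /\ forall w z, normc w <= M -> normc z <= M ->
    normc (w ^+ e a) <= K a /\ normc (w ^+ e a - z ^+ e a) <= K a * normc (w - z).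
  rewrite /K; case: cid2 => k /= k0 hk; split=> // w z wM zM.
  by have := hk w z wM zM; rewrite !hornerXn.
exists (\sum_a K a * rnorm (y a)).
  by rewrite sumr_ge0// => a _; rewrite mulr_ge0 ?rnorm_ge0//; case: (KP a).
move=> w z wM zM; split.
  rewrite (le_trans (rnorm_sum _))// ler_sum// => a _.
  by rewrite rnormZ ler_wpM2r ?rnorm_ge0//; case: (KP a) => _ /(_ _ _ wM zM) [].
rewrite -sumrB (le_trans (rnorm_sum _))// mulr_suml ler_sum// => a _.
rewrite -scalerBl rnormZ mulrAC ler_wpM2r ?rnorm_ge0//.
by case: (KP a) => _ /(_ _ _ wM zM) [].
Qed.

(* The maximum principle for [(1 - g / n) ^ n f], where the scalar factor tends
   to [exp (- g)]. *)
Lemma exp_majorant (X : normedModType R[i]) (A : finType) (e : A -> nat)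
    (y : A -> X) (g : {poly R[i]}) (rho t : R) : 0 <= rho <= 1 ->
    (forall u, rnorm (vpoly e y (cis u)) <= expR (Re g.[cis u])) ->
  rnorm (vpoly e y (rho%:C * cis t)) <= expR (Re g.[rho%:C * cis t]).
Proof.
move=> hrho hfg; set a := rnorm _; set u := Re _.
suff H eps : 0 < eps -> a <= expR (u + eps).
  have [a0|a0] := ltP 0 a; last by rewrite (le_trans a0)// expR_ge0.
  rewrite -[a]lnK ?posrE// ler_expR; apply/ler_addgt0Pr => eps eps0.
  by rewrite -ler_expR lnK ?posrE// H.
move=> eps0; have [K K0 HK] := horner_lipschitz g 1.
have HK1 v : normc g.[cis v] <= K.
  by have [] := HK (cis v) (cis v); rewrite ?normc_cis.
have hK : 0 <= (K ^+ 2 / 2 + 2 * u ^+ 2) / eps.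
  apply: divr_ge0 (ltW eps0).
  by have := sqr_ge0 K; have := sqr_ge0 u; lra.
(* Two demands on n: n > 2|u|, so that n - u >= n/2, and n eps >= K^2/2 + 2u^2, which is the total
   error of the two estimates below. *)
pose n := (Num.bound (`|2 * u| + (K ^+ 2 / 2 + 2 * u ^+ 2) / eps)).+1.
have nB : `|2 * u| + (K ^+ 2 / 2 + 2 * u ^+ 2) / eps < n%:R.
  rewrite /n; apply: (@lt_trans _ _ (Num.bound (`|2 * u| + (K ^+ 2 / 2 + 2 * u ^+ 2) / eps))%:R).
    2: by rewrite ltr_nat.
  apply: archi_boundP.
  by rewrite addr_ge0.
have n0 : 0 < n%:R :> R by rewrite ltr0n.
have nu : `|2 * u| < n%:R.
  by apply: le_lt_trans nB; rewrite lerDl.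
have ne : K ^+ 2 / 2 + 2 * u ^+ 2 <= n%:R * eps.
  rewrite -ler_pdivrMr// ltW//; apply: le_lt_trans nB; rewrite lerDr//.
pose q := (1 - (n%:R^-1)%:C *: g) ^+ n.
have qE w : q.[w] = (1 - (n%:R^-1)%:C * g.[w]) ^+ n.
  by rewrite horner_exp hornerD hornerN hornerZ hornerC.
have M1 v : normc q.[cis v] * rnorm (vpoly e y (cis v)) <= expR (K ^+ 2 / 2 / n%:R).
  (* |1 - g/n|^2 = 1 - 2 Re g / n + |g|^2 / n^2 is at most the exponential of its last two terms;
     the n-th power then gives |q| <= exp(- Re g + K^2 / (2n)). *)
  have hb : normc (1 - (n%:R^-1)%:C * g.[cis v]) <=
      expR (- Re g.[cis v] / n%:R + K ^+ 2 / 2 / n%:R ^+ 2).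
    rewrite -(ler_pXn2r (n := 2))// ?nnegrE ?normc_ge0 ?expR_ge0//.
    rewrite -expRM_natl; apply: le_trans (expR_ge1Dx _).
    have gK : normc g.[cis v] ^+ 2 <= K ^+ 2.
      by rewrite ler_pXn2r ?nnegrE ?normc_ge0.
    move: gK; rewrite !normc_sqr; set x := g.[_]; rewrite ReB ImD ImN ReZ ImM /=.
    rewrite !mul0r !addr0 add0r.
    set N := n%:R in n0 *; set a1 := Re x; set b1 := Im x => gK.
    rewrite -subr_ge0.
    have -> : 1 + 2%:R * (- a1 / N + K ^+ 2 / 2 / N ^+ 2) -
      ((1 - N^-1 * a1) ^+ 2 + (- (N^-1 * b1)) ^+ 2) =
      (K ^+ 2 - (a1 ^+ 2 + b1 ^+ 2)) / N ^+ 2.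
      by field; rewrite gt_eqF.
    by rewrite divr_ge0 ?subr_ge0// sqr_ge0.
  rewrite qE normcX.
  apply: le_trans (ler_pM (exprn_ge0 _ (normc_ge0 _)) (rnorm_ge0 _)
    (_ : _ <= expR (- Re g.[cis v] / n%:R + K ^+ 2 / 2 / n%:R ^+ 2) ^+ n)
    (hfg v)) _.
    by rewrite ler_pXn2r// ?nnegrE ?normc_ge0 ?expR_ge0.
  rewrite -expRM_natl -expRD ler_expR le_eqVlt; apply/orP; left; apply/eqP.
  by field; rewrite gt_eqF.
have := maximum_principle t hrho M1; rewrite -/a => hmax.
have un : u < n%:R.
  move: nu; rewrite ltr_norml => /andP[]; lra.
(* At the interior point |1 - g/n| >= 1 - u/n, and the inverse of 1 - u/n is 1 + u/(n - u) <=
   exp(u/(n - u)). *)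
have lowq : expR (- u * n%:R / (n%:R - u)) <= normc q.[rho%:C * cis t].
  rewrite qE normcX.
  have -> : - u * n%:R / (n%:R - u) = n%:R * (- u / (n%:R - u)) by rewrite mulrCA mulrA mulrC mulrA.
  rewrite expRM_natl ler_pXn2r ?nnegrE ?expR_ge0 ?normc_ge0//.
  apply: (@le_trans _ _ (1 - u / n%:R)); last first.
    apply: le_trans (ler_norm _) _; apply: le_trans (le_Re_normc _) => //.
    by rewrite ReB ReZ -/u mulrC.
  rewrite mulNr expRN -[leRHS]invrK lef_pV2 ?posrE ?expR_gt0 ?invr_gt0 ?subr_gt0 ?ltr_pdivrMr ?mul1r//.
  apply: le_trans (expR_ge1Dx _); rewrite le_eqVlt; apply/orP; left; apply/eqP.
  by field; rewrite !gt_eqF ?subr_gt0.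
have : expR (- u * n%:R / (n%:R - u)) * a <= expR (K ^+ 2 / 2 / n%:R).
  by apply: le_trans hmax; rewrite ler_wpM2r// rnorm_ge0.
rewrite -ler_pdivlMl ?expR_gt0// => /le_trans; apply.
rewrite -expRN -expRD ler_expR.
have -> : - (- u * n%:R / (n%:R - u)) + K ^+ 2 / 2 / n%:R =
    u + (u ^+ 2 / (n%:R - u) + K ^+ 2 / 2 / n%:R).
  by field; rewrite !gt_eqF ?subr_gt0.
rewrite lerD2l.
apply: le_trans (_ : u ^+ 2 / (n%:R / 2) + K ^+ 2 / 2 / n%:R <= _).
  rewrite lerD2r ler_wpM2l ?sqr_ge0// lef_pV2 ?posrE ?subr_gt0 ?divr_gt0//.
  move: nu; rewrite ltr_norml => /andP[]; lra.
rewrite -(ler_pM2l n0); apply: le_trans ne.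
rewrite le_eqVlt; apply/orP; left; apply/eqP.
by field; rewrite !gt_eqF.
Qed.

End vector_polynomials.

(** * Means over the circle *)

Section circle_mean.
Context {R : realType}.
Notation mu := (@lebesgue_measure R).
Implicit Types (f g : R -> R) (a b : R).

Lemma is_derive_continuous f (x l : R) : is_derive x 1 f l -> {for x, continuous f}.
Proof.
by move=> h; apply/differentiable_continuous/derivable1_diffP.
Qed.

Lemma continuous_integrable f a b :
  continuous f -> mu.-integrable `[a, b] (EFin \o f).
Proof.
move=> cf; apply: continuous_compact_integrable; first exact: segment_compact.
exact: continuous_subspaceT.
Qed.

Lemma derivable_LRcontinuous f (df : R -> R) a b :
  (forall x : R, x \in `[a, b] -> is_derive x 1 f (df x)) -> a < b ->
  derivable_oo_LRcontinuous f a b.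
Proof.
move=> h ab; split.
- by move=> x xab; have [] := h x (subset_itv_oo_cc xab).
- apply: cvg_at_right_filter; apply: is_derive_continuous (h a _).
  by rewrite in_itv/= lexx ltW.
- apply: cvg_at_left_filter; apply: is_derive_continuous (h b _).
  by rewrite in_itv/= lexx ltW.
Qed.

Lemma Rintegral_derive f (df : R -> R) a b : a < b -> continuous df ->
  (forall x : R, x \in `[a, b] -> is_derive x 1 f (df x)) ->
  \int[mu]_(t in `[a, b]) df t = f b - f a.
Proof.
move=> ab cdf h; rewrite /Rintegral (@continuous_FTC2 _ df f)//.
- exact: continuous_subspaceT.
- exact: derivable_LRcontinuous h ab.
- by move=> x xab; rewrite derive1E; apply: derive_val; apply: h; exact: subset_itv_oo_cc.
Qed.

Lemma derive0_eq f a b : a <= b ->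
  (forall x : R, x \in `[a, b] -> is_derive x 1 f 0) -> f b = f a.
Proof.
move=> ab h.
have cf : {within `[a, b], continuous f}.
  by apply: derivable_within_continuous => x /h [].
have [c _] := MVT_segment ab (fun x xab => h x (subset_itv_oo_cc xab)) cf.
by rewrite mul0r => /eqP; rewrite subr_eq0 => /eqP.
Qed.

Definition circle_mean f := (pi *+ 2)^-1 * \int[mu]_(t in `[0, pi *+ 2]) f t.

Lemma circle_meanD f g : continuous f -> continuous g ->
  circle_mean (fun t => f t + g t) = circle_mean f + circle_mean g.
Proof.
by move=> cf cg; rewrite /circle_mean RintegralD ?mulrDr//; exact: continuous_integrable.
Qed.

Lemma circle_meanZ (k : R) f : continuous f ->
  circle_mean (fun t => k * f t) = k * circle_mean f.
Proof.
move=> cf; rewrite /circle_mean RintegralZl//; last exact: continuous_integrable.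
by rewrite mulrCA.
Qed.

Lemma circle_mean_le f g : continuous f -> continuous g ->
  (forall t, f t <= g t) -> circle_mean f <= circle_mean g.
Proof.
move=> cf cg fg; rewrite ler_wpM2l ?invr_ge0 ?(ltW (pi2_gt0 R))//.
by apply: le_Rintegral => //; exact: continuous_integrable.
Qed.

Lemma circle_mean_cst (k : R) : circle_mean (fun=> k) = k.
Proof.
rewrite /circle_mean Rintegral_cst//= lebesgue_measure_itv/= lte_fin pi2_gt0.
by rewrite sube0 /= mulrCA mulVf ?mulr1// gt_eqF// pi2_gt0.
Qed.

Lemma continuous_sum_ord (n : nat) (F : 'I_n -> R -> R) :
  (forall i, continuous (F i)) -> continuous (fun t => \sum_i F i t).
Proof.
elim: n F => [|n IHn] F cF t.
  by under eq_fun do rewrite big_ord0; exact: cvg_cst.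
under eq_fun do rewrite big_ord_recl.
by apply: cvgD; [exact: cF|apply: (IHn (fun i => F (lift ord0 i)))].
Qed.

Lemma circle_mean_sum (n : nat) (F : 'I_n -> R -> R) :
  (forall i, continuous (F i)) ->
  circle_mean (fun t => \sum_i F i t) = \sum_i circle_mean (F i).
Proof.
elim: n F => [|n IHn] F cF.
  by rewrite big_ord0; under eq_fun do rewrite big_ord0; rewrite circle_mean_cst.
rewrite big_ord_recl -IHn => [|i]; last exact: cF.
under eq_fun do rewrite big_ord_recl.
by rewrite circle_meanD//; exact: continuous_sum_ord.
Qed.

Lemma circle_mean_derive f (df : R -> R) : continuous df ->
  (forall t : R, is_derive t 1 f (df t)) -> f (pi *+ 2) = f 0 -> circle_mean df = 0.
Proof.
move=> cdf h f2pi; rewrite /circle_mean (@Rintegral_derive f df _ _ (@pi2_gt0 R) cdf (fun t _ => h t)) f2pi.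
by rewrite subrr mulr0.
Qed.

Lemma continuous_shift f a : continuous f -> continuous (fun t => f (t + a)).
Proof.
by move=> cf t; apply: continuous_comp; [exact: cvgD (cvg_id) (cvg_cst a)|exact: cf].
Qed.

(** For an antiderivative Phi of [f], the function Phi(2 pi + x) - Phi(x) has derivative f(2 pi + x)
    - f(x) = 0, so the integral over a period does not depend on the starting point. *)
Lemma circle_mean_shift f (a : R) : continuous f -> (forall t, f (t + pi *+ 2) = f t) ->
  circle_mean (fun t => f (t + a)) = circle_mean f.
Proof.
move=> cf f2pi; rewrite /circle_mean; congr (_ * _).
(* The margin 1 keeps every x and 2 pi + x with |x| <= |a| in the interior of [-A, B], where the
   fundamental theorem gives a two-sided derivative. *)
pose A := `|a| + 1; pose B := pi *+ 2 + `|a| + 1.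
pose Phi x := \int[mu]_(t in `[- A, x]) f t.
have p0 := @pi2_gt0 R.
have [la ua] : - `|a| <= a /\ a <= `|a| by split; rewrite ?ler_norm// lerNl -normrN ler_norm.
have na := normr_ge0 a.
have dPhi x : - A < x < B -> is_derive x 1 Phi (f x).
  move=> /andP[Ax xB].
  have [dx ex] := @continuous_FTC1_closed R f (- A) x B xB
    (@continuous_integrable f (- A) B cf) Ax (cf x).
  exact: DeriveDef dx (etrans (esym (derive1E Phi x)) ex).
have shiftE x : - `|a| <= x <= `|a| ->
    \int[mu]_(t in `[0, pi *+ 2]) f (t + x) = Phi (pi *+ 2 + x) - Phi x.
  move=> /andP[lx ux].
  have cfx := @continuous_shift f x cf.
  have dx t : t \in `[0, pi *+ 2] -> is_derive t 1 (fun t => Phi (t + x)) (f (t + x)).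
    rewrite in_itv/= => /andP[t0 t2]; rewrite -[X in is_derive _ _ _ X]mulr1.
    apply: (@is_derive1_comp _ Phi (fun t => t + x)).
      apply: dPhi; rewrite /A /B; apply/andP; split; lra.
    exact: is_derive_shift.
  by rewrite (Rintegral_derive p0 cfx dx) add0r.
pose D x := Phi (pi *+ 2 + x) - Phi x.
have dD x : - `|a| <= x <= `|a| -> is_derive x 1 D 0.
  move=> /andP[lx ux]; rewrite -(subrr (f x)) -{1}(f2pi x) (addrC x).
  apply: is_deriveB; last by apply: dPhi; rewrite /A /B; apply/andP; split; lra.
  rewrite -[X in is_derive _ _ _ X]mulr1.
  apply: (@is_derive1_comp _ Phi (fun x => pi *+ 2 + x)).
    apply: dPhi; rewrite /A /B; apply/andP; split; lra.
  rewrite (_ : (fun x => _) = shift (pi *+ 2)); first exact: is_derive_shift.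
  by apply/funext => y /=; rewrite addrC.
rewrite shiftE ?la//.
have -> : (fun t => f t) = (fun t => f (t + 0)) by apply/funext => t; rewrite addr0.
rewrite shiftE ?oppr_le0 ?na//.
rewrite -/(D a) -/(D 0).
have [a0|a0] := leP 0 a; [|apply/esym]; apply: derive0_eq; rewrite ?(ltW a0)//.
  by move=> x; rewrite in_itv/= => /andP[x0 xa]; apply: dD; apply/andP; split; lra.
by move=> x; rewrite in_itv/= => /andP[x0 xa]; apply: dD; apply/andP; split; lra.
Qed.

Lemma is_derive_circle_mean (F dF : R -> R -> R) (a u v K : R) : u < a < v ->
  (forall x, u < x < v -> continuous (F x)) ->
  (forall x t, u < x < v -> is_derive x 1 (F ^~ t) (dF x t)) ->
  (forall x t, u < x < v -> `|dF x t| <= K) ->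
  is_derive a 1 (fun x => circle_mean (F x)) (circle_mean (dF a)).
Proof.
move=> uav cF h hK.
have Iab x : x \in `]u, v[ -> u < x < v by rewrite in_itv.
have K0 : 0 <= K by apply: le_trans (normr_ge0 _) (hK a 0 uav).
have dE x t : u < x < v -> partial1of2 F x t = dF x t.
  by move=> ux; rewrite partial1of2E; apply: derive_val; exact: h.
have intF x : (`]u, v[%classic : set R) x ->
  mu.-integrable `[0, pi *+ 2] (EFin \o F x) by move=> /Iab ux; exact/continuous_integrable/cF.
have derF x y : (`]u, v[%classic : set R) x -> (`[0, pi *+ 2]%classic : set R) y ->
    derivable (F ^~ y) x 1.
  by move=> /Iab ux _; have [] := h x y ux.
have intG : mu.-integrable `[0, pi *+ 2] (EFin \o (fun=> K)).
  by apply: continuous_integrable => ?; exact: cvg_cst.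
have ubG x y : (`]u, v[%classic : set R) x -> (`[0, pi *+ 2]%classic : set R) y ->
  `|partial1of2 F x y| <= K by move=> /Iab ux _; rewrite dE// hK.
have Ia : (`]u, v[%classic : set R) a by rewrite /= in_itv.
have D1 := @derivable_under_integral R _ _ mu F _ (measurable_itv _) a u v Ia intF derF
  _ (fun=> K0) intG ubG.
have D2 := @differentiation_under_integral R _ _ mu F _ (measurable_itv _) a u v Ia intF derF
  _ (fun=> K0) intG ubG.
rewrite /circle_mean; apply: is_deriveZ; apply: DeriveDef => //.
rewrite -derive1E D2; apply: eq_Rintegral => t _.
exact: dE.
Qed.

End circle_mean.

(** * Uniform approximation by real parts of polynomials *)

Section trigonometric_approximation.
Context {R : realType}.
Implicit Types (F : R -> R) (t : R).

(** A discrete convolution: [t + unity_arg n k] is the difference between t and the node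
    [- unity_arg n k]. It depends on [F] only through [n] samples and on t through a trigonometric
    polynomial. *)
Definition tpoisson_conv (rho : R) L n F t :=
  n%:R^-1 * \sum_(k < n) F (- unity_arg n k) *
    tpoisson rho L (cis (t + unity_arg n k)).

Lemma normc_cisB t u : normc (cis t - cis u) ^+ 2 = 2 - 2 * cos (t - u).
Proof.
rewrite normc_sqr /= cosB; have := cos2Dsin2 t; have := cos2Dsin2 u.
set a := cos t; set b := sin t; set c := cos u; set d := sin u => h1 h2.
transitivity ((c ^+ 2 + d ^+ 2) + (a ^+ 2 + b ^+ 2) - 2 * (a * c + b * d)).
  by ring.
by rewrite h1 h2; ring.
Qed.

(* Korovkin's argument: the kernel is a probability whose variance is
   2 (1 - rho). *)
Lemma tpoisson_conv_approx (K delta : R) : 0 <= K -> 0 < delta ->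
  exists (rho : R) (L n : nat), forall F,
    (forall t u, `|F t - F u| <= K * normc (cis t - cis u)) ->
    forall t, `|tpoisson_conv rho L n F t - F t| <= delta.
Proof.
(* Chosen so that the variance term K^2 eta / delta is at most delta / 2; adding delta^2 to K^2
   covers K = 0 and keeps eta below 1. *)
move=> K0 d0; pose eta := delta ^+ 2 / (2 * (K ^+ 2 + delta ^+ 2)).
have D0 : 0 < K ^+ 2 + delta ^+ 2 by rewrite ltr_wpDl ?sqr_ge0// exprn_gt0.
have eta0 : 0 < eta by rewrite divr_gt0 ?mulr_gt0 ?exprn_gt0.
have eta1 : eta <= 1.
  by rewrite ler_pdivrMr ?mulr_gt0//; have := sqr_ge0 K; have := sqr_ge0 delta; lra.
have hrho : 0 <= 1 - eta < 1 by apply/andP; split; lra.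
have [L L1 hL] := exists_degree 1 hrho.
(* Only the moments 0 and 1 are needed, and for these [L + 2] nodes suffice. *)
exists (1 - eta), L, L.+2 => F hF t.
set n := L.+2; set rho := 1 - eta in hL *.
have n0 : 0 < n%:R :> R by rewrite ltr0n.
pose w k := n%:R^-1 * tpoisson rho L (cis (t + unity_arg n k)).
have w0 k : 0 <= w k by rewrite mulr_ge0 ?invr_ge0 ?(ltW n0)// tpoisson_ge0.
have w1 : \sum_(k < n) w k = 1.
  have h0 : (L + 0 < n)%N by rewrite addn0 ltnS leqnSn.
  have := congr1 Re (tpoisson_moment rho t (leq0n L) h0).
  rewrite expr0 mulr1 Re_sum -[n%:R in RHS](rmorph_nat (real_complex R)) ReC => h.
  rewrite -mulr_sumr -[X in _ * X](_ : n%:R = _) ?mulVf ?gt_eqF//.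
  by rewrite -h; apply: eq_bigr => k _; rewrite expr0 mulr1.
have wc : \sum_(k < n) w k * cos (t + unity_arg n k) = rho.
  have h1 : (L + 1 < n)%N by rewrite addn1.
  have := congr1 Re (tpoisson_moment rho t L1 h1).
  rewrite expr1 Re_sum -[n%:R in RHS](rmorph_nat (real_complex R)) ReZ ReC => h.
  under eq_bigr do rewrite -mulrA; rewrite -mulr_sumr.
  rewrite -[X in _ * X](_ : n%:R * rho = _) ?mulrA ?mulVf ?mul1r ?gt_eqF//.
  by rewrite -h; apply: eq_bigr => k _; rewrite expr1 ReZ.
have -> : tpoisson_conv rho L n F t - F t =
    \sum_(k < n) w k * (F (- unity_arg n k) - F t).
  under eq_bigr do rewrite mulrBr; rewrite sumrB -mulr_suml w1 mul1r; congr (_ - _).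
  by rewrite /tpoisson_conv mulr_sumr; apply: eq_bigr => k _; rewrite mulrCA mulrC.
clearbody w; rewrite (le_trans (ler_norm_sum _ _ _))//.
(* The Lipschitz bound K x is replaced by delta/2 + K^2 x^2 / (2 delta), since the squared chord x^2
   = 2 - 2 cos is computable from the first moment. *)
apply: (@le_trans _ _ (\sum_(k < n) w k *
    (delta / 2 + K ^+ 2 / (2 * delta) * (2 - 2 * cos (t + unity_arg n k))))).
  apply: ler_sum => k _; rewrite normrM ger0_norm// ler_wpM2l// distrC.
  apply: le_trans (hF _ _) _.
  have := normc_cisB t (- unity_arg n k); rewrite opprK => <-.
  set x := normc _; rewrite -subr_ge0.
  have -> : delta / 2 + K ^+ 2 / (2 * delta) * x ^+ 2 - K * x =
      (delta - K * x) ^+ 2 / (2 * delta) by field; rewrite gt_eqF.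
  by rewrite divr_ge0 ?sqr_ge0// mulr_ge0// ltW.
have -> : \sum_(k < n) w k *
    (delta / 2 + K ^+ 2 / (2 * delta) * (2 - 2 * cos (t + unity_arg n k))) =
    delta / 2 + K ^+ 2 / delta * (1 - rho).
  transitivity (\sum_(k < n) ((delta / 2 + K ^+ 2 / delta) * w k -
      K ^+ 2 / delta * (w k * cos (t + unity_arg n k)))).
    by apply: eq_bigr => k _; field; rewrite gt_eqF.
  by rewrite sumrB -!mulr_sumr w1 wc; ring.
have -> : delta / 2 + K ^+ 2 / delta * (1 - rho) =
    delta / 2 + delta / 2 * (K ^+ 2 / (K ^+ 2 + delta ^+ 2)).
  by rewrite /rho /eta; field; rewrite !gt_eqF.
have : K ^+ 2 / (K ^+ 2 + delta ^+ 2) <= 1.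
  by rewrite ler_pdivrMr// mul1r lerDl sqr_ge0.
nra.
Qed.

(** The kernel is the real part of a polynomial in cis t and the samples of [F] are real, so the
    discrete convolution is itself the real part of a polynomial. *)
Lemma weierstrass F (K delta : R) : 0 <= K -> 0 < delta ->
  (forall t u, `|F t - F u| <= K * normc (cis t - cis u)) ->
  exists G : {poly R[i]}, forall t, `|Re G.[cis t] - F t| <= delta.
Proof.
move=> K0 d0 hF; have [rho [L [n h]]] := tpoisson_conv_approx K0 d0.
pose T k : {poly R[i]} := 2%:P * (\sum_(l < L.+1) (rho%:C * cis (unity_arg n k)) ^+ l *: 'X^l) - 1.
exists (\sum_(k < n) (n%:R^-1 * F (- unity_arg n k))%:C *: T k) => t.
suff -> : Re (\sum_(k < n) (n%:R^-1 * F (- unity_arg n k))%:C *: T k).[cis t] =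
  tpoisson_conv rho L n F t by exact: h.
rewrite horner_sum Re_sum /tpoisson_conv mulr_sumr; apply: eq_bigr => k _.
rewrite hornerZ ReZ -mulrA; congr (_ * (_ * _)).
rewrite /T hornerD hornerN hornerM !hornerC ReB horner_sum /tpoisson; congr (_ - _).
rewrite -[2 : R[i]](rmorph_nat (real_complex R)) ReZ; congr (_ * Re _).
apply: eq_bigr => l _; rewrite hornerZ hornerXn -exprMn cisD.
by rewrite -mulrA [cis t * _]mulrC.
Qed.

(** The chain rule along a real curve a + ib. Real and imaginary parts are proved together because
    multiplication by the variable mixes them in the induction. *)
Lemma is_derive_horner (P : {poly R[i]}) (a b : R -> R) (x a' b' : R) :
  is_derive x 1 a a' -> is_derive x 1 b b' ->
  is_derive x 1 (fun x => Re P.[a x +i* b x]) (Re (P^`().[a x +i* b x] * (a' +i* b'))) /\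
  is_derive x 1 (fun x => Im P.[a x +i* b x]) (Im (P^`().[a x +i* b x] * (a' +i* b'))).
Proof.
move=> ha hb; elim/poly_ind: P => [|P c [IHr IHi]].
  rewrite derivC horner0 mul0r; split.
    by under eq_fun do rewrite horner0; exact: is_derive_cst.
  by under eq_fun do rewrite horner0; exact: is_derive_cst.
have E x' : (P * 'X + c%:P).[x'] = P.[x'] * x' + c by rewrite !hornerE.
split.
  under eq_fun do rewrite E ReD ReM.
  have h := is_deriveD (is_deriveB (is_deriveM IHr ha) (is_deriveM IHi hb))
    (is_derive_cst (Re c) x 1).
  apply: (is_derive_eq h).
  rewrite derivD derivM derivX derivC addr0 !hornerE.
  rewrite !(ReM, ImM, ReD, ImD) /= /GRing.scale /=; ring.
under eq_fun do rewrite E ImD ImM.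
have h := is_deriveD (is_deriveD (is_deriveM IHr hb) (is_deriveM IHi ha))
  (is_derive_cst (Im c) x 1).
apply: (is_derive_eq h).
rewrite derivD derivM derivX derivC addr0 !hornerE.
rewrite !(ReM, ImM, ReD, ImD) /= /GRing.scale /=; ring.
Qed.

End trigonometric_approximation.

(** * Entropy contraction *)

Section entropy.
Context {R : realType}.
Implicit Types (G P : {poly R[i]}) (x t rho : R).

Lemma polarE x t : x%:C * cis t = (x * cos t) +i* (x * sin t).
Proof. by rewrite /cis; simpc. Qed.

Lemma is_derive_radial P t x :
  is_derive x 1 (fun x => Re P.[x%:C * cis t]) (Re (P^`().[x%:C * cis t] * cis t)).
Proof.
under eq_fun do rewrite polarE; rewrite polarE.
have h (k : R) : is_derive x 1 (fun x => x * k) k.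
  have := is_deriveM (is_derive_id x 1) (is_derive_cst k x 1).
  by move=> /is_derive_eq; apply; rewrite scaler0 add0r /GRing.scale /= mulr1.
exact: (is_derive_horner P (h _) (h _)).1.
Qed.

Lemma is_derive_angular P x t :
  is_derive t 1 (fun t => Re P.[x%:C * cis t])
    (- x * Im (P^`().[x%:C * cis t] * cis t)) /\
  is_derive t 1 (fun t => Im P.[x%:C * cis t])
    (x * Re (P^`().[x%:C * cis t] * cis t)).
Proof.
under eq_fun do rewrite polarE; under [X in _ /\ is_derive _ _ X _]eq_fun do rewrite polarE.
rewrite polarE.
have hc : is_derive t 1 (fun t => x * cos t) (- (x * sin t)).
  by apply: (is_derive_eq (is_deriveZ x (is_derive_cos t))); rewrite /GRing.scale /= mulrN.
have hs : is_derive t 1 (fun t => x * sin t) (x * cos t).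
  exact: (is_deriveZ x (is_derive_sin t)).
have [h1 h2] := is_derive_horner P hc hs; split.
  by apply: (is_derive_eq h1); rewrite !(ReM, ImM) /=; ring.
by apply: (is_derive_eq h2); rewrite !(ReM, ImM) /=; ring.
Qed.

Lemma continuous_Re_horner P x : continuous (fun t => Re P.[x%:C * cis t]).
Proof. by move=> t; apply: is_derive_continuous (is_derive_angular P x t).1. Qed.

Lemma continuous_Im_horner P x : continuous (fun t => Im P.[x%:C * cis t]).
Proof. by move=> t; apply: is_derive_continuous (is_derive_angular P x t).2. Qed.

Lemma Re_horner_quadrature G x rho d n (kappa theta : 'I_n -> R) t :
  is_quadrature rho d kappa theta -> (size G <= d.+1)%N ->
  Re G.[(rho * x)%:C * cis t] = \sum_k kappa k * Re G.[x%:C * cis (t + theta k)].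
Proof.
move=> hq sG; rewrite rmorphM -mulrA (horner_quadrature _ hq sG) Re_sum.
by apply: eq_bigr => k _; rewrite ReZ cisD mulrA.
Qed.

Lemma hornerXM P w : ('X * P).[w] = w * P.[w].
Proof. by rewrite hornerM hornerX. Qed.

(** Tangent bound: a^2 / b >= 2 a c - c^2 b for every c, with difference (a - c b)^2 / b; averaging
    at c = S / B gives equality on the left-hand side. *)
Lemma perspective_convex n (kappa a b : 'I_n -> R) :
  (forall k, 0 <= kappa k) -> (forall k, 0 < b k) -> 0 < \sum_k kappa k * b k ->
  (\sum_k kappa k * a k) ^+ 2 / (\sum_k kappa k * b k) <=
  \sum_k kappa k * (a k ^+ 2 / b k).
Proof.
move=> k0 b0; set B := \sum_k kappa k * b k; set S := \sum_k _ * a k => B0.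
pose c := S / B.
have -> : S ^+ 2 / B = \sum_k kappa k * (2 * a k * c - c ^+ 2 * b k).
  transitivity (2 * c * S - c ^+ 2 * B); first by rewrite /c; field; rewrite gt_eqF.
  by rewrite /S /B !mulr_sumr -sumrB; apply: eq_bigr => k _; ring.
apply: ler_sum => k _; rewrite ler_wpM2l// -subr_ge0.
have -> : a k ^+ 2 / b k - (2 * a k * c - c ^+ 2 * b k) = (a k - c * b k) ^+ 2 / b k.
  by field; rewrite gt_eqF.
by rewrite divr_ge0 ?sqr_ge0// ltW.
Qed.

(** The Fisher information of the density Re G on the circle of radius x: by the Cauchy-Riemann
    equations |G'|^2 is the squared gradient of Re G. *)
Definition fisher G x :=
  circle_mean (fun t => normc (G^`().[x%:C * cis t]) ^+ 2 / Re G.[x%:C * cis t]).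

Lemma continuous_div (f g : R -> R) : continuous f -> continuous g ->
  (forall t, 0 < g t) -> continuous (fun t => f t / g t).
Proof.
move=> cf cg g0 t; apply: cvgM; first exact: cf.
by apply: cvgV; [rewrite gt_eqF|exact: cg].
Qed.

Lemma continuous_normc2 P x : continuous (fun t => normc (P.[x%:C * cis t]) ^+ 2).
Proof.
move=> t; under eq_fun do rewrite normc_sqr !expr2.
by apply: cvgD; apply: cvgM; (exact: continuous_Re_horner || exact: continuous_Im_horner).
Qed.

(** One quadrature expresses both G and G' at radius rho x as the same convex combination of rotated
    values at radius x. Joint convexity, used for Re G' and for Im G', compares the integrands, and
    rotations do not change the mean. *)
Lemma fisher_le G x rho : 0 <= rho <= 1 -> (forall t, 0 < Re G.[x%:C * cis t]) ->
  fisher G (rho * x) <= fisher G x.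
Proof.
move=> hrho G0.
have [n [kappa [theta hq]]] := exists_quadrature (size G) hrho.
have [k0 _] := hq.
have rxE t : (rho * x)%:C * cis t = rho%:C * (x%:C * cis t) by rewrite rmorphM mulrA.
have GE t : Re G.[(rho * x)%:C * cis t] =
    \sum_k kappa k * Re G.[x%:C * cis (t + theta k)].
  exact: Re_horner_quadrature hq (leqnSn _).
(* The weights sum to 1, so they cannot all vanish and an average of positive values stays
   positive. *)
have G0' t : 0 < Re G.[(rho * x)%:C * cis t].
  rewrite GE lt_neqAle sumr_ge0 ?andbT => [|k _]; last by rewrite mulr_ge0// ltW.
  apply/eqP => /esym/eqP; rewrite psumr_eq0 => [|k _]; last by rewrite mulr_ge0// ltW.
  move=> /allP h; have := is_quadrature_sum hq.
  rewrite big1 => [/eqP|k _]; first by rewrite eq_sym oner_eq0.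
  by have /eqP := h k (mem_index_enum _); move=> /eqP; rewrite mulf_eq0 [X in _ || X]gt_eqF// orbF => /eqP.
pose f t := normc (G^`().[x%:C * cis t]) ^+ 2 / Re G.[x%:C * cis t].
have cf : continuous f.
  by apply: continuous_div => //; [exact: continuous_normc2|exact: continuous_Re_horner].
have cfs k : continuous (fun t => f (t + theta k)) by exact: continuous_shift.
have fs k : circle_mean (fun t => f (t + theta k)) = fisher G x.
  rewrite circle_mean_shift// => t; by rewrite /f cis_periodic.
have ckf k : continuous (fun t => kappa k * f (t + theta k)).
  by move=> t; apply: cvgM; [exact: cvg_cst|exact: cfs].
have -> : fisher G x = circle_mean (fun t => \sum_k kappa k * f (t + theta k)).
  rewrite circle_mean_sum// (eq_bigr (fun k => kappa k * fisher G x)); last first.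
    by move=> k _; rewrite circle_meanZ// fs.
  by rewrite -mulr_suml (is_quadrature_sum hq) mul1r.
apply: circle_mean_le.
- by apply: continuous_div => //; [exact: continuous_normc2|exact: continuous_Re_horner].
- exact: continuous_sum_ord.
move=> t; rewrite GE rxE.
have sG' : (size G^`() <= (size G).+1)%N.
  by rewrite (leq_trans (size_poly _ _))// (leq_trans (leq_pred _)).
rewrite (horner_quadrature _ hq sG') normc_sqr mulrDl.
have E1 : Re (\sum_(k < n) (kappa k)%:C * G^`().[x%:C * cis t * cis (theta k)]) =
    \sum_k kappa k * Re G^`().[x%:C * cis (t + theta k)].
  by rewrite Re_sum; apply: eq_bigr => k _; rewrite ReZ cisD mulrA.
have E2 : Im (\sum_(k < n) (kappa k)%:C * G^`().[x%:C * cis t * cis (theta k)]) =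
    \sum_k kappa k * Im G^`().[x%:C * cis (t + theta k)].
  rewrite Im_sum; apply: eq_bigr => k _.
  by rewrite ImM mul0r addr0 cisD mulrA.
rewrite E1 E2.
under [leRHS]eq_bigr do rewrite /f normc_sqr mulrDl mulrDr.
by rewrite big_split lerD// perspective_convex// -GE.
Qed.

End entropy.

Section entropy_contraction.
Context {R : realType}.
Implicit Types (G P : {poly R[i]}) (x t rho : R).

Lemma minimum_principle G c x t : 0 <= x <= 1 ->
  (forall u, c <= Re G.[cis u]) -> c <= Re G.[x%:C * cis t].
Proof.
move=> hx hc; have [n [kappa [theta hq]]] := exists_quadrature (size G) hx.
rewrite -[x in x%:C]mulr1 (Re_horner_quadrature _ _ hq (leqnSn _)).
have {1}-> : c = \sum_k kappa k * c by rewrite -mulr_suml (is_quadrature_sum hq) mul1r.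
by apply: ler_sum => k _; rewrite ler_wpM2l ?(hq.1 k)// mul1r.
Qed.

(** Differentiating in the radius at the endpoints 0 and 1 needs Re G bounded away from 0 on an open
    interval around [0, 1]. *)
Lemma minimum_principle_margin G c : 0 < c -> (forall u, c <= Re G.[cis u]) ->
  exists2 eta, 0 < eta <= 1 &
    forall x t, - eta < x < 1 + eta -> c / 2 <= Re G.[x%:C * cis t].
Proof.
move=> c0 hc; have [K K0 hK] := horner_lipschitz G 2.
(* Clipping a radius to [0, 1] moves it by at most eta and hence G by at most K eta <= c / 2;
   [K + 1] avoids a zero divisor, and eta <= 1 keeps all radii below 2. *)
pose eta := Num.min 1 (c / (2 * (K + 1))).
have e0 : 0 < eta by rewrite lt_min ltr01 divr_gt0// mulr_gt0// ltr_wpDl.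
have e1 : eta <= 1 by rewrite ge_min lexx.
have eK : K * eta <= c / 2.
  have : eta <= c / (2 * (K + 1)) by rewrite ge_min lexx orbT.
  rewrite ler_pdivlMr ?mulr_gt0// ?ltr_wpDl//; lra.
exists eta; first by rewrite e0.
move=> x t /andP[x0 x1].
suff [x' [/andP[x'0 x'1] xx']] : exists x', 0 <= x' <= 1 /\ `|x - x'| <= eta.
  have n1 (a : R) : normc (a%:C * cis t) = `|a| by rewrite Normc.normcM normcC normc_cis mulr1.
  have [_ h] : normc G.[x'%:C * cis t] <= K /\
      normc (G.[x'%:C * cis t] - G.[x%:C * cis t]) <= K * normc (x'%:C * cis t - x%:C * cis t).
    by apply: hK; rewrite n1 ler_norml; apply/andP; split; lra.
  have : Re (G.[x'%:C * cis t] - G.[x%:C * cis t]) <= c / 2.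
    rewrite (le_trans (ler_norm _))// (le_trans (le_Re_normc _))// (le_trans h)//.
    by rewrite -mulrBl -rmorphB n1 (le_trans _ eK)// ler_wpM2l// distrC.
  have := minimum_principle t (_ : 0 <= x' <= 1) hc; rewrite x'0 x'1 => /(_ isT).
  by rewrite ReB; lra.
have [x00|x00] := ltP x 0.
  exists 0; rewrite lexx ler01; split=> //.
  by rewrite subr0 ler_norml; apply/andP; split; lra.
have [x11|x11] := ltP 1 x.
  exists 1; rewrite lexx ler01; split=> //.
  by rewrite ler_norml; apply/andP; split; lra.
exists x; rewrite x00 x11 subrr normr0; split=> //; exact: ltW.
Qed.

(* With y(x) the mean of H ln H on the circle of radius x, H = Re G, one has
   x (x y')' = x^2 (Fisher information at x), and the latter is nondecreasing;
   hence rho^2 y(x) - y(rho x) is nondecreasing in x. *)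
Lemma entropy_contraction G rho c : 0 <= rho <= 1 -> 0 < c ->
  (forall u, c <= Re G.[cis u]) ->
  circle_mean (fun t => Re G.[rho%:C * cis t] * ln (Re G.[rho%:C * cis t])) -
    Re G.[0] * ln (Re G.[0]) <=
  rho ^+ 2 * (circle_mean (fun t => Re G.[cis t] * ln (Re G.[cis t])) -
    Re G.[0] * ln (Re G.[0])).
Proof.
move=> /andP[rho0 rho1] c0 hc.
have [eta /andP[e0 e1] hb] := minimum_principle_margin c0 hc.
pose b := c / 2; have b0 : 0 < b by rewrite divr_gt0.
pose H x t := Re G.[x%:C * cis t].
(* On the circle of radius x, Re Q is x times the radial derivative of H and Im Q is minus its
   angular derivative. Being a polynomial, Q is harmless at x = 0. *)
pose Q := 'X * G^`().
pose D P x t := Re (P^`().[x%:C * cis t] * cis t).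
have bH x t : - eta < x < 1 + eta -> b <= H x t by exact: hb.
have H0 x t : - eta < x < 1 + eta -> 0 < H x t by move=> /(bH x t); exact: lt_le_trans.
have bound P : exists2 K, 0 <= K & forall x t, - eta < x < 1 + eta -> normc P.[x%:C * cis t] <= K.
  have [K K0 hK] := horner_lipschitz P 2; exists K => // x t /andP[x0 x1].
  have n1 : normc (x%:C * cis t) <= 2.
    rewrite Normc.normcM normcC normc_cis mulr1 ler_norml; apply/andP; split; lra.
  by have [] := hK _ _ n1 n1.
have [KG KG0 hKG] := bound G; have [KD KD0 hKD] := bound G^`().
have [KQ KQ0 hKQ] := bound Q; have [KE KE0 hKE] := bound Q^`().
have ubD P K x t : (forall x t, - eta < x < 1 + eta -> normc P^`().[x%:C * cis t] <= K) ->
    - eta < x < 1 + eta -> `|D P x t| <= K.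
  move=> hP xe; rewrite /D (le_trans (le_Re_normc _))// Normc.normcM normc_cis mulr1.
  exact: hP.
(* H takes values in [b, KG], so L bounds its logarithm; with the polynomial bounds above this
   yields the constants needed to differentiate under the integral. *)
pose L := `|ln b| + `|ln KG|.
have lnH x t : - eta < x < 1 + eta -> `|ln (H x t)| <= L.
  move=> xe; have h1 : ln b <= ln (H x t) by rewrite ler_ln ?posrE ?bH// H0.
  have HK : H x t <= KG.
    by apply: le_trans (hKG x t xe); rewrite (le_trans (ler_norm _))// le_Re_normc.
  have h2 : ln (H x t) <= ln KG by rewrite ler_ln ?posrE ?H0// (lt_le_trans (H0 x t xe)).
  have := ler_norm (ln KG); have := ler_norm (- ln b); rewrite normrN.
  have := normr_ge0 (ln KG); have := normr_ge0 (ln b).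
  by rewrite ler_norml /L => *; apply/andP; split; lra.
have cH x : continuous (H x) by exact: continuous_Re_horner.
have clnH x : - eta < x < 1 + eta -> continuous (fun t => ln (H x t)).
  by move=> xe t; apply: continuous_comp; [exact: cH|exact/continuous_ln/H0].
have cln1 x : - eta < x < 1 + eta -> continuous (fun t => ln (H x t) + 1).
  by move=> xe t; apply: cvgD; [exact: clnH|exact: cvg_cst].
have cD P x : continuous (D P x).
  have -> : D P x = fun t => Re P^`().[x%:C * cis t] * cos t - Im P^`().[x%:C * cis t] * sin t.
    by apply/funext => t; rewrite /D ReM.
  move=> t; apply: cvgB; apply: cvgM; (exact: continuous_Re_horner ||
    exact: continuous_Im_horner || exact: continuous_cos || exact: continuous_sin).
have dlnH x t : - eta < x < 1 + eta ->
    is_derive x 1 (fun x => ln (H x t)) ((H x t)^-1 * D G x t).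
  move=> xe; have h := is_derive_radial G t x.
  exact (@is_derive1_comp _ (@ln R) (H^~ t) x _ _ (is_derive1_ln (H0 x t xe)) h).
pose y x := circle_mean (fun t => H x t * ln (H x t)).
pose y1 x := circle_mean (fun t => D G x t * (ln (H x t) + 1)).
have dy x : - eta < x < 1 + eta -> is_derive x 1 y (y1 x).
  move=> xe; apply: (@is_derive_circle_mean _ (fun x t => H x t * ln (H x t))
    (fun x t => D G x t * (ln (H x t) + 1)) x (- eta) (1 + eta) (KD * (L + 1)) xe).
  - by move=> x' xe' t; apply: cvgM; [exact: cH|exact: clnH].
  - move=> x' t xe'.
    have h := is_deriveM (is_derive_radial G t x') (dlnH x' t xe').
    apply: (is_derive_eq h); rewrite /GRing.scale /= -/(H x' t) -/(D G x' t).
    by field; rewrite gt_eqF// H0.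
  move=> x' t xe'; rewrite normrM ler_pM// ?(ubD G)//.
  by rewrite (le_trans (ler_normD _ _))// normr1 lerD2r lnH.
pose B x := circle_mean (fun t => Re Q.[x%:C * cis t] * (ln (H x t) + 1)).
have QE x t : Re Q.[x%:C * cis t] = x * D G x t.
  by rewrite /Q hornerXM /D -mulrA ReZ [cis t * _]mulrC.
have QI x t : Im Q.[x%:C * cis t] = x * Im (G^`().[x%:C * cis t] * cis t).
  by rewrite /Q hornerXM -mulrA ImM mul0r addr0 /= [cis t * _]mulrC.
have BE x : - eta < x < 1 + eta -> B x = x * y1 x.
  move=> xe; rewrite /B /y1 -circle_meanZ; last first.
    by move=> t; apply: cvgM; [exact: cD|exact: cln1].
  by congr circle_mean; apply/funext => t; rewrite QE mulrA.
pose b1 x := circle_mean (fun t => D Q x t * (ln (H x t) + 1) +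
  Re Q.[x%:C * cis t] * D G x t / H x t).
have dB x : - eta < x < 1 + eta -> is_derive x 1 B (b1 x).
  move=> xe; apply: (@is_derive_circle_mean _
    (fun x t => Re Q.[x%:C * cis t] * (ln (H x t) + 1))
    (fun x t => D Q x t * (ln (H x t) + 1) + Re Q.[x%:C * cis t] * D G x t / H x t)
    x (- eta) (1 + eta) (KE * (L + 1) + KQ * KD / b) xe).
  - by move=> x' xe' t; apply: cvgM; [exact: continuous_Re_horner|exact: cln1].
  - move=> x' t xe'.
    have h := is_deriveM (is_derive_radial Q t x')
      (is_deriveD (dlnH x' t xe') (is_derive_cst (1 : R) x' 1)).
    apply: (is_derive_eq h); rewrite /GRing.scale /= -/(H x' t) -/(D G x' t) -/(D Q x' t).
    by rewrite addr0 fctE /cst /=; field; rewrite gt_eqF// H0.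
  move=> x' t xe'; rewrite (le_trans (ler_normD _ _))// lerD//.
    rewrite normrM ler_pM// ?(ubD Q)//.
    by rewrite (le_trans (ler_normD _ _))// normr1 lerD2r lnH.
  rewrite !normrM; apply: ler_pM; rewrite ?mulr_ge0//.
    apply: ler_pM => //; last exact: (ubD G).
    by rewrite (le_trans (le_Re_normc _))// hKQ.
  by rewrite normfV lef_pV2 ?posrE// ?normr_gt0 ?gt_eqF ?H0// ger0_norm ?bH// ltW// H0.
have b1E x : - eta < x < 1 + eta -> 0 < x -> b1 x = x * fisher G x.
  move=> xe x0; have xn0 : x != 0 by rewrite gt_eqF.
  apply: (mulfI xn0); rewrite [RHS]mulrA -expr2.
  have cf2 : continuous (fun t => Re Q.[x%:C * cis t] * D G x t / H x t).
    move=> t; apply: continuous_div => // t'; last exact: H0.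
    by apply: cvgM; [exact: continuous_Re_horner|exact: cD].
  have cf1 : continuous (fun t => D Q x t * (ln (H x t) + 1)).
    by move=> t; apply: cvgM; [exact: cD|exact: cln1].
  have cf4 : continuous (fun t => Im Q.[x%:C * cis t] ^+ 2 / H x t).
    apply: continuous_div => // t'; last exact: H0.
    by under eq_fun do rewrite expr2; apply: cvgM; exact: continuous_Im_horner.
  have cf3 : continuous (fun t => x * D Q x t * (ln (H x t) + 1) -
      Im Q.[x%:C * cis t] ^+ 2 / H x t).
    move=> t; apply: cvgB.
      by apply: cvgM; [apply: cvgM; [exact: cvg_cst|exact: cD]|exact: cln1].
    exact: cf4.
  (* Integration by parts in the angle: by Cauchy-Riemann the angular derivative of Im Q is x times
     the radial derivative of Re Q, so the integrand is the derivative of a periodic function.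
     Subtracting it removes the logarithm from x b1(x) and leaves the mean of ((Re Q)^2 + (Im Q)^2)
     / H = x^2 |G'|^2 / H. *)
  have parts : circle_mean (fun t => x * D Q x t * (ln (H x t) + 1) -
      Im Q.[x%:C * cis t] ^+ 2 / H x t) = 0.
    apply: (@circle_mean_derive _ (fun t => Im Q.[x%:C * cis t] * (ln (H x t) + 1))) => //.
      move=> t; have [hG _] := is_derive_angular G x t.
      have [_ hQ] := is_derive_angular Q x t.
      have hl := is_derive1_comp (is_derive1_ln (H0 x t xe)) hG.
      have h := is_deriveM hQ (is_deriveD hl (is_derive_cst (1 : R) t 1)).
      apply: (is_derive_eq h); rewrite addr0 fctE /cst /GRing.scale /= -/(D Q x t) QI -/(H x t).
      by field; rewrite gt_eqF// H0.
    by rewrite /H -[pi *+ 2]add0r cis_periodic.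
  have cG : continuous (fun t => normc (G^`().[x%:C * cis t]) ^+ 2 / Re G.[x%:C * cis t]).
    apply: continuous_div; [exact: continuous_normc2|exact: continuous_Re_horner|].
    by move=> t; exact: H0.
  rewrite /b1 /fisher -circle_meanZ//; last by move=> t; apply: cvgD; [exact: cf1|exact: cf2].
  rewrite -circle_meanZ// -[RHS]add0r -[in RHS]parts -circle_meanD//; last first.
    by move=> t; apply: cvgM; [exact: cvg_cst|exact: cG].
  congr circle_mean; apply/funext => t.
  have -> : normc G^`().[x%:C * cis t] ^+ 2 =
      D G x t ^+ 2 + Im (G^`().[x%:C * cis t] * cis t) ^+ 2.
    by rewrite /D -normc_sqr Normc.normcM normc_cis mulr1.
  rewrite QE QI -/(H x t); field; rewrite gt_eqF// H0//.
have x01 (k x : R) : 0 <= k <= 1 -> 0 <= x <= 1 -> - eta < k * x < 1 + eta.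
  move=> /andP[k0 k1] /andP[x0 x1].
  by have := mulr_ge0 k0 x0; have := mulr_ile1 k0 x0 k1 x1 => *; apply/andP; split; lra.
have x01' x : 0 <= x <= 1 -> - eta < x < 1 + eta.
  by move=> /andP[x0 x1]; apply/andP; split; lra.
have rho01 : 0 <= rho <= 1 by rewrite rho0.
have drho x : is_derive x 1 (fun x => rho * x) rho.
  have := is_deriveZ rho (is_derive_id x (1 : R)).
  by move=> /is_derive_eq; apply; rewrite /GRing.scale /= mulr1.
(* E(x) is x times the derivative of the function F introduced below, and E'(x) is rho^2 x times the
   increase of the Fisher information from rho x to x. *)
pose E x := rho ^+ 2 * B x - B (rho * x).
have dE x : 0 <= x <= 1 -> is_derive x 1 E (rho ^+ 2 * b1 x - rho * b1 (rho * x)).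
  move=> hx; have h1 := dB _ (x01 _ _ rho01 hx).
  have h := is_deriveB (is_deriveZ (rho ^+ 2) (dB x (x01' x hx))) (is_derive1_comp h1 (drho x)).
  by apply: (is_derive_eq h); rewrite /GRing.scale /= [X in _ - X]mulrC.
have E0 : E 0 = 0 by rewrite /E mulr0 BE ?mul0r ?mulr0 ?subrr//; apply/andP; split; lra.
have Ege0 x : 0 <= x <= 1 -> 0 <= E x.
  move=> /andP[x0 x1]; rewrite -E0.
  apply: (@ger0_derive1_ndecr _ E 0 1 _ _ _ 0 x (lexx 0) x0 x1).
  - by move=> z; rewrite in_itv/= => /andP[z0 z1]; have [] := dE z _; first by rewrite !ltW.
  - move=> z; rewrite in_itv/= => /andP[z0 z1].
    have hz : 0 <= z <= 1 by rewrite !ltW.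
    rewrite derive1E (@derive_val _ _ _ _ _ _ _ (dE z hz)).
    (* [b1E] requires a positive radius, so rho = 0 is treated apart; the derivative is then 0. *)
    move: rho0; rewrite le_eqVlt => /predU1P[<-|rho0']; first by rewrite expr0n !mul0r subrr.
    rewrite !b1E ?mulr_gt0 ?x01 ?x01'//.
    have h := @fisher_le _ G z rho rho01 (fun t => H0 z t (x01' z hz)).
    have -> : rho ^+ 2 * (z * fisher G z) - rho * (rho * z * fisher G (rho * z)) =
        rho ^+ 2 * z * (fisher G z - fisher G (rho * z)) by ring.
    by rewrite mulr_ge0 ?subr_ge0// mulr_ge0 ?sqr_ge0// (ltW z0).
  apply: derivable_within_continuous => z; rewrite in_itv/= => hz.
  by have [] := dE z hz.
pose F x := rho ^+ 2 * y x - y (rho * x).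
have dF x : 0 <= x <= 1 -> is_derive x 1 F (rho ^+ 2 * y1 x - rho * y1 (rho * x)).
  move=> hx; have h1 := dy _ (x01 _ _ rho01 hx).
  have h := is_deriveB (is_deriveZ (rho ^+ 2) (dy x (x01' x hx))) (is_derive1_comp h1 (drho x)).
  by apply: (is_derive_eq h); rewrite /GRing.scale /= [X in _ - X]mulrC.
have : F 0 <= F 1.
  apply: (@ger0_derive1_ndecr _ F 0 1 _ _ _ 0 1 (lexx 0) ler01 (lexx 1)).
  - by move=> z; rewrite in_itv/= => /andP[z0 z1]; have [] := dF z _; first by rewrite !ltW.
  - move=> z; rewrite in_itv/= => /andP[z0 z1].
    have hz : 0 <= z <= 1 by rewrite !ltW.
    rewrite derive1E (@derive_val _ _ _ _ _ _ _ (dF z hz)).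
    rewrite -(pmulr_rge0 _ z0); have := Ege0 z hz.
    by rewrite /E !BE ?x01 ?x01'// !mulrBr; lra.
  apply: derivable_within_continuous => z; rewrite in_itv/= => hz.
  by have [] := dF z hz.
have y0 : y 0 = Re G.[0] * ln (Re G.[0]).
  rewrite /y /H; under eq_fun do rewrite mul0r.
  exact: circle_mean_cst.
have y1E : y 1 = circle_mean (fun t => Re G.[cis t] * ln (Re G.[cis t])).
  by congr circle_mean; apply/funext => t; rewrite /H mul1r.
by rewrite /F !mulr0 mulr1 y0 y1E /y /H; lra.
Qed.
End entropy_contraction.

(** * One variable *)

Section scalar_hypercontractivity.
Context {R : realType}.
Implicit Types (g G : {poly R[i]}) (s r rho : R) (f p : R -> R).

Lemma continuous_Re_cis G : continuous (fun t => Re G.[cis t]).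
Proof.
have -> : (fun t => Re G.[cis t]) = (fun t => Re G.[1%:C * cis t]).
  by apply/funext => t; rewrite mul1r.
exact: continuous_Re_horner.
Qed.

(** Weights and moments are real, so conjugating the moment equations only reflects the nodes. *)
Lemma is_quadratureN rho d n (kappa theta : 'I_n -> R) :
  is_quadrature rho d kappa theta -> is_quadrature rho d kappa (fun k => - theta k).
Proof.
move=> [k0 hq]; split=> // j jd; move: (hq j jd) => h.
have hR := congr1 Re h; have hI := congr1 Im h.
rewrite -rmorphXn Re_sum ReC in hR; rewrite -rmorphXn Im_sum /= in hI.
apply/eqP; rewrite eq_complex -rmorphXn Re_sum Im_sum -hR; apply/andP; split; apply/eqP.
  by apply: eq_bigr => k _; rewrite !ReZ !cisX /= mulNrn cosN.
rewrite [RHS]/= -[RHS]oppr0 -[in RHS]hI -sumrN; apply: eq_bigr => k _.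
by rewrite !ImM !mul0r !addr0 !cisX /= mulNrn sinN mulrN.
Qed.

(** A quadrature at radius 0 writes Re G(0) as an average of rotates of Re G, all with the same
    mean. *)
Lemma circle_mean_Re_horner G : circle_mean (fun t => Re G.[cis t]) = Re G.[0].
Proof.
have h01 : 0 <= (0 : R) <= 1 by rewrite lexx ler01.
have [n [kappa [theta hq]]] := exists_quadrature (size G) h01.
have E t : Re G.[0] = \sum_k kappa k * Re G.[cis (t + theta k)].
  have := Re_horner_quadrature 1 t hq (leqnSn _).
  by rewrite mul0r mul0r => ->; apply: eq_bigr => k _; rewrite mul1r.
have cG   := @continuous_Re_cis G.
rewrite -[RHS]circle_mean_cst.
have -> : (fun=> Re G.[0]) = (fun t => \sum_k kappa k * Re G.[cis (t + theta k)]).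
  by apply/funext => t; exact: E.
have cGk k : continuous (fun t => Re G.[cis (t + theta k)]).
  exact: (@continuous_shift _ _ (theta k) cG).
rewrite circle_mean_sum => [|k]; last first.
  by move=> t; apply: cvgM; [exact: cvg_cst|exact: cGk].
rewrite (eq_bigr (fun k => kappa k * circle_mean (fun t => Re G.[cis t]))).
  by rewrite -mulr_suml (is_quadrature_sum hq) mul1r.
move=> k _; rewrite circle_meanZ//; congr (_ * _).
by apply: (circle_mean_shift (theta k) cG) => t; rewrite cis_periodic.
Qed.

(** Dilation averages rotations; a rotation by theta_k moves from g to G with the opposite sign, and
    the reflected nodes form a quadrature for the same radius. *)
Lemma circle_mean_dilation_adjoint g G rho : 0 <= rho <= 1 ->
  circle_mean (fun t => Re G.[cis t] * Re g.[rho%:C * cis t]) =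
  circle_mean (fun t => Re G.[rho%:C * cis t] * Re g.[cis t]).
Proof.
move=> hrho; pose d := maxn (size G) (size g).
have [n [kappa [theta hq]]] := exists_quadrature d hrho.
have cG   := @continuous_Re_cis G; have cg   := @continuous_Re_cis g.
have Eg t : Re g.[rho%:C * cis t] = \sum_k kappa k * Re g.[cis (t + theta k)].
  have sg : (size g <= d.+1)%N by rewrite (leq_trans (leq_maxr _ _) (leqnSn _)).
  have := Re_horner_quadrature 1 t hq sg.
  by rewrite mulr1 => ->; apply: eq_bigr => k _; rewrite mul1r.
have EG t : Re G.[rho%:C * cis t] = \sum_k kappa k * Re G.[cis (t - theta k)].
  have sG : (size G <= d.+1)%N by rewrite (leq_trans (leq_maxl _ _) (leqnSn _)).
  have := Re_horner_quadrature 1 t (is_quadratureN hq) sG.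
  by rewrite mulr1 => ->; apply: eq_bigr => k _; rewrite mul1r.
have cGg a b : continuous (fun t => Re G.[cis (t + a)] * Re g.[cis (t + b)]).
  by move=> t; apply: cvgM; [exact: (@continuous_shift _ _ a cG)|exact: (@continuous_shift _ _ b cg)].
have cGgk k a b : continuous (fun t => kappa k * (Re G.[cis (t + a)] * Re g.[cis (t + b)])).
  by move=> t; apply: cvgM; [exact: cvg_cst|exact: cGg].
transitivity (\sum_k kappa k *
  circle_mean (fun t => Re G.[cis (t + 0)] * Re g.[cis (t + theta k)])).
  under [RHS]eq_bigr do rewrite -circle_meanZ//.
  rewrite -circle_mean_sum//; congr circle_mean; apply/funext => t.
  by rewrite Eg mulr_sumr; apply: eq_bigr => k _; rewrite addr0 mulrCA.
transitivity (\sum_k kappa k *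
  circle_mean (fun t => Re G.[cis (t - theta k)] * Re g.[cis (t + 0)])).
  apply: eq_bigr => k _; congr (_ * _).
  rewrite -(circle_mean_shift (theta k) (cGg (- theta k) 0)); last first.
    by move=> t; rewrite ![t + pi *+ 2 + _]addrAC !cis_periodic.
  congr circle_mean; apply/funext => t.
  by rewrite -!addrA subrr !addr0.
under eq_bigr do rewrite -circle_meanZ//.
rewrite -circle_mean_sum//; congr circle_mean; apply/funext => t.
by rewrite EG mulr_suml; apply: eq_bigr => k _; rewrite addr0 mulrA.
Qed.

Lemma continuous_mul f p : continuous f -> continuous p -> continuous (fun t => f t * p t).
Proof. by move=> cf cp t; apply: cvgM; [exact: cf|exact: cp]. Qed.

Lemma continuous_scale (k : R) f : continuous f -> continuous (fun t => k * f t).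
Proof. by move=> cf t; apply: cvgM; [exact: cvg_cst|exact: cf]. Qed.

Lemma continuous_exp f : continuous f -> continuous (fun t => expR (f t)).
Proof.
by move=> cf t; apply: continuous_comp; [exact: cf|exact: continuous_expR].
Qed.

Lemma continuous_log f : continuous f -> (forall t, 0 < f t) ->
  continuous (fun t => ln (f t)).
Proof.
by move=> cf f0 t; apply: continuous_comp; [exact: cf|exact: continuous_ln].
Qed.

Lemma circle_mean_ge f (c : R) : continuous f -> (forall t, c <= f t) -> c <= circle_mean f.
Proof.
move=> cf hc; rewrite -[leLHS]circle_mean_cst; apply: circle_mean_le => //.
by move=> t; exact: cvg_cst.
Qed.

(** This is 1 + x <= exp x at x = b - ln a, multiplied by a; a ln a - a and exp b are Legendre
    conjugates. *)
Lemma young_entropy (a b : R) : 0 < a -> a * b <= a * ln a - a + expR b.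
Proof.
move=> a0; have := expR_ge1Dx (b - ln a); rewrite expRD expRN lnK ?posrE//.
rewrite ler_pdivlMr// => h; apply: le_trans (_ : a * ln a - a + (1 + (b - ln a)) * a <= _); lra.
Qed.

(** Young's inequality is applied at f - ln Z + ln M, the shift for which the mean of the
    exponential is M and cancels the term - M. *)
Lemma gibbs f p (c l : R) : continuous f -> continuous p ->
  0 < c -> (forall t, c <= p t) -> (forall t, l <= f t) ->
  circle_mean (fun t => p t * f t) <=
  circle_mean p * ln (circle_mean (fun t => expR (f t))) +
  circle_mean (fun t => p t * ln (p t)) - circle_mean p * ln (circle_mean p).
Proof.
move=> cf cp c0 pc fl; set Z := circle_mean (fun t => expR (f t)); set M := circle_mean p.
have p0 t : 0 < p t by exact: lt_le_trans (pc t).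
have M0 : 0 < M by apply: lt_le_trans c0 _; exact: circle_mean_ge.
have cef := continuous_exp cf.
have Z0 : 0 < Z.
  apply: lt_le_trans (expR_gt0 l) _; apply: circle_mean_ge => // t.
  by rewrite ler_expR.
have cpf := continuous_mul cp cf.
have cpp := continuous_mul cp (continuous_log cp p0).
have cpk := @continuous_scale (ln M - ln Z) _ cp.
have ceM := @continuous_scale (M / Z) _ cef.
have cNp := @continuous_scale (- 1) _ cp.
have h : circle_mean (fun t => p t * f t + (ln M - ln Z) * p t) <=
    circle_mean (fun t => (p t * ln (p t) + (- 1) * p t) + M / Z * expR (f t)).
  apply: circle_mean_le.
  - by move=> t; apply: cvgD; [exact: cpf|exact: cpk].
  - by move=> t; apply: cvgD; [apply: cvgD; [exact: cpp|exact: cNp]|exact: ceM].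
  move=> t; have := young_entropy (f t - ln Z + ln M) (p0 t).
  rewrite !expRD expRN !lnK ?posrE//.
  have -> : M / Z * expR (f t) = expR (f t) / Z * M by rewrite mulrC mulrCA mulrC.
  lra.
rewrite circle_meanD// circle_meanZ// circle_meanD// in h; last first.
  by move=> t; apply: cvgD; [exact: cpp|exact: cNp].
rewrite circle_meanD// !circle_meanZ// -/M -/Z in h.
have e : M / Z * Z = M by rewrite divfK// gt_eqF.
rewrite e in h; lra.
Qed.

Lemma exp_lipschitz f (K B : R) : (forall t, `|f t| <= B) ->
  (forall t u, `|f t - f u| <= K * normc (cis t - cis u)) ->
  forall t u, `|expR (f t) - expR (f u)| <= expR B * K * normc (cis t - cis u).
Proof.
move=> fB hf t u.
wlog tu : t u / f u <= f t => [H|].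
  have [/H//|/ltW/H] := leP (f u) (f t).
  by rewrite distrC -(normcN (cis t - cis u)) opprB.
rewrite ger0_norm ?subr_ge0 ?ler_expR//.
have ft : expR (f t) <= expR B.
  by rewrite ler_expR (le_trans _ (fB t))// ler_norm.
apply: (@le_trans _ _ (expR (f t) * (f t - f u))).
  have : expR (f t) * (1 + (f u - f t)) <= expR (f u).
    by rewrite -{2}(subrK (f t) (f u)) expRD mulrC ler_wpM2r ?expR_ge0// expR_ge1Dx.
  lra.
rewrite -mulrA; apply: ler_pM; rewrite ?expR_ge0 ?subr_ge0//.
by apply: le_trans (hf t u); rewrite ler_norm.
Qed.

(* [expR (r u_rho)], with [u_rho t = Re g.[rho * cis t]], is sandwiched up to a
   factor [1 + d] by a trigonometric polynomial [h = Re G]; the Gibbs inequality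
   for [h_rho] against [s u] and the entropy contraction then bound [ln] of the
   mean of [h]. *)
Lemma scalar_hypercontractivity g s r : 0 < s -> s <= r ->
  circle_mean (fun t => expR (r * Re g.[(Num.sqrt (s / r))%:C * cis t])) <=
  circle_mean (fun t => expR (s * Re g.[cis t])) `^ (r / s).
Proof.
move=> s0 sr; have r0 : 0 < r by exact: lt_le_trans sr.
set rho := Num.sqrt (s / r).
have rho2 : rho ^+ 2 = s / r by rewrite sqr_sqrtr// divr_ge0 ?ltW.
have hrho : 0 <= rho <= 1.
  by rewrite sqrtr_ge0 -sqrtr1 ler_wsqrtr// ler_pdivrMr// mul1r.
have [K K0 hK] := horner_lipschitz g 1.
have n1 (x t : R) : 0 <= x <= 1 -> normc (x%:C * cis t) <= 1.
  by move=> /andP[x0 x1]; rewrite Normc.normcM normcC normc_cis mulr1 ger0_norm.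
have gK w : normc w <= 1 -> `|Re g.[w]| <= K.
  by move=> hw; rewrite (le_trans (le_Re_normc _))//; case: (hK w w hw hw).
pose f t := r * Re g.[rho%:C * cis t]; pose B := r * K.
have fB t : `|f t| <= B.
  by rewrite normrM gtr0_norm// ler_pM2l// gK// n1.
have fL t u : `|f t - f u| <= B * normc (cis t - cis u).
  rewrite /f -mulrBr normrM gtr0_norm// -mulrA ler_pM2l// -ReB.
  rewrite (le_trans (le_Re_normc _))//.
  case: (hK (rho%:C * cis t) (rho%:C * cis u)) => [||_ h]; rewrite ?n1//.
  apply: le_trans h _; rewrite ler_wpM2l// -mulrBr Normc.normcM normcC.
  case/andP: hrho => rho0 rho1.
  by rewrite ger0_norm// -[leRHS]mul1r ler_wpM2r// normc_ge0.
have wL := exp_lipschitz fB fL.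
pose c := expR (- B); have c0 : 0 < c by exact: expR_gt0.
have cw t : c <= expR (f t).
  by rewrite ler_expR; have := fB t; rewrite ler_norml => /andP[].
pose Z := circle_mean (fun t => expR (s * Re g.[cis t])).
have cg := @continuous_Re_cis g.
have csg := @continuous_scale s _ cg.
have lsg t : - (s * K) <= s * Re g.[cis t].
  rewrite -mulrN ler_pM2l//; have := gK (cis t); rewrite normc_cis lexx => /(_ isT).
  by rewrite ler_norml => /andP[].
have Z0 : 0 < Z.
  apply: lt_le_trans (expR_gt0 (- (s * K))) _; apply: circle_mean_ge.
    exact: continuous_exp csg.
  by move=> t; rewrite ler_expR.
have cf : continuous f.
  exact: (@continuous_scale r _ (@continuous_Re_horner _ g rho)).
rewrite -/Z -/(circle_mean (fun t => expR (f t))).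
suff H (d : R) : 0 < d -> circle_mean (fun t => expR (f t)) <= Z `^ (r / s) * (1 + d).
  have P0 : 0 < Z `^ (r / s) by exact: powR_gt0.
  apply/ler_addgt0Pr => e e0; have := H (e / Z `^ (r / s)) (divr_gt0 e0 P0).
  by rewrite mulrDr mulr1 [_ * (e / _)]mulrC divfK// gt_eqF.
move=> d0.
(* Approximating (1 + d/2) exp f within (d/2) c, where c bounds exp f from below, traps Re G between
   exp f and (1 + d) exp f. *)
have wL' t u : `|(1 + d / 2) * expR (f t) - (1 + d / 2) * expR (f u)| <=
    (1 + d / 2) * (expR B * B) * normc (cis t - cis u).
  rewrite -mulrBr normrM ger0_norm; last by lra.
  by rewrite -[leRHS]mulrA ler_pM2l//; lra.
have K'0 : 0 <= (1 + d / 2) * (expR B * B).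
  by rewrite mulr_ge0 ?mulr_ge0 ?expR_ge0 ?(ltW r0)//; lra.
have e0 : 0 < d / 2 * c by rewrite mulr_gt0// divr_gt0.
have [G hG] := weierstrass K'0 e0 wL'.
have Gw t : expR (f t) <= Re G.[cis t] <= (1 + d) * expR (f t).
  have := hG t; have : d / 2 * c <= d / 2 * expR (f t) by rewrite ler_pM2l ?cw// divr_gt0.
  rewrite ler_norml => h1 /andP[h2 h3]; apply/andP; split; lra.
have Gc t : c <= Re G.[cis t] by apply: le_trans (cw t) _; case/andP: (Gw t).
have G0 t : 0 < Re G.[cis t] by exact: lt_le_trans (Gc t).
have cG := @continuous_Re_cis G.
have cGr := @continuous_Re_horner _ G rho.
have Gc' t : c <= Re G.[rho%:C * cis t] by exact: minimum_principle.
have m0 : 0 < Re G.[0].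
  by rewrite -circle_mean_Re_horner; apply: lt_le_trans c0 _; exact: circle_mean_ge.
set m := Re G.[0] in m0.
have mE : circle_mean (fun t => Re G.[rho%:C * cis t]) = m.
  have hh t : Re (G \Po (rho%:C *: 'X)).[cis t] = Re G.[rho%:C * cis t].
    by rewrite horner_comp hornerZ hornerX.
  rewrite /m -[in RHS](mulr0 rho%:C) -[in RHS](hornerX (0 : R[i])) -hornerZ -horner_comp.
  by rewrite -circle_mean_Re_horner; congr circle_mean; apply/funext => t; rewrite hh.
have g1 := gibbs csg cGr c0 Gc' lsg.
rewrite mE -/Z in g1.
have g2 := entropy_contraction hrho c0 Gc; rewrite -/m rho2 in g2.
have g3 : circle_mean (fun t => Re G.[rho%:C * cis t] * (s * Re g.[cis t])) =
    s / r * circle_mean (fun t => Re G.[cis t] * f t).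
  have E1 : (fun t => Re G.[rho%:C * cis t] * (s * Re g.[cis t])) =
    (fun t => s * (Re G.[rho%:C * cis t] * Re g.[cis t])).
    by apply/funext => t; rewrite mulrCA.
  have E2 : (fun t => Re G.[cis t] * f t) =
    (fun t => r * (Re G.[cis t] * Re g.[rho%:C * cis t])).
    by apply/funext => t; rewrite mulrCA.
  rewrite E1 E2 !circle_meanZ ?circle_mean_dilation_adjoint ?mulrA ?divfK ?gt_eqF//.
    exact: (continuous_mul cG (@continuous_Re_horner _ g rho)).
  exact: (continuous_mul cGr cg).
have g4 : circle_mean (fun t => Re G.[cis t] * ln (Re G.[cis t])) <=
    circle_mean (fun t => Re G.[cis t] * f t) + ln (1 + d) * m.
  rewrite /m -circle_mean_Re_horner -circle_meanZ// -circle_meanD; last 2 first.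
  - exact: continuous_mul.
  - exact: @continuous_scale _ _ cG.
  apply: circle_mean_le.
  - exact: continuous_mul cG (continuous_log cG G0).
  - move=> t; apply: cvgD; first exact: continuous_mul.
    exact: (@continuous_scale _ _ cG).
  move=> t; rewrite [ln (1 + d) * _]mulrC -mulrDr ler_pM2l//.
  have d1 : 0 < 1 + d by lra.
  rewrite -[f t]expRK -lnM ?posrE ?expR_gt0// ler_ln ?posrE ?mulr_gt0 ?expR_gt0//.
  by rewrite mulrC; case/andP: (Gw t).
(* In the combination of [g1] to [g4] the term (s/r) mean(h ln h), with h = Re G, occurs on both
   sides and cancels. *)
have g5 : ln m <= r / s * ln Z + ln (1 + d).
  have sr0 : 0 < s / r * m by rewrite !mulr_gt0// invr_gt0.
  rewrite -(ler_pM2l sr0).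
  have -> : s / r * m * (r / s * ln Z + ln (1 + d)) = m * ln Z + s / r * (ln (1 + d) * m).
    by field; rewrite !gt_eqF.
  have sr1 : 0 < s / r by rewrite divr_gt0.
  have := ler_wpM2l (ltW sr1) g4; rewrite mulrDr -g3.
  have -> : s / r * m * ln m = s / r * (m * ln m) by rewrite mulrA.
  move: g2; rewrite mulrBr; move: g1; lra.
apply: (@le_trans _ _ m).
  rewrite /m -circle_mean_Re_horner; apply: circle_mean_le => //; first exact: continuous_exp.
  by move=> t; case/andP: (Gw t).
rewrite -[leLHS]lnK ?posrE// /powR gt_eqF// -[1 + d in leRHS]lnK ?posrE; last by lra.
by rewrite -expRD ler_expR.
Qed.

End scalar_hypercontractivity.

(** * From scalar exponentials to norms of vector-valued polynomials *)

Section vector_hypercontractivity.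
Context {R : realType}.
Implicit Types (s r rho : R) (f : R -> R).

Lemma lipschitz_continuous f (K : R) :
  (forall t u, `|f t - f u| <= K * normc (cis t - cis u)) -> continuous f.
Proof.
move=> hf t; apply/cvgrPdist_le => e e0.
have K1 : 0 < `|K| + 1 by rewrite ltr_wpDl.
have d0 : 0 < e / (`|K| + 1) / 2 by rewrite !divr_gt0.
have /cvgrPdist_le /(_ _ d0) Hc := @continuous_cos R t.
have /cvgrPdist_le /(_ _ d0) Hs := @continuous_sin R t.
near=> u.
have hc : `|cos t - cos u| <= e / (`|K| + 1) / 2 by near: u.
have hs : `|sin t - sin u| <= e / (`|K| + 1) / 2 by near: u.
apply: le_trans (hf t u) _.
have h : normc (cis t - cis u) <= `|cos t - cos u| + `|sin t - sin u|.
  rewrite -(ler_pXn2r (n := 2)) ?nnegrE ?normc_ge0 ?addr_ge0//.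
  rewrite normc_sqr /= [leRHS]sqrrD !real_normK ?num_real//.
  by rewrite lerD2r lerDl mulrn_wge0// mulr_ge0.
apply: (@le_trans _ _ ((`|K| + 1) * (e / (`|K| + 1)))); last by rewrite mulrC divfK ?gt_eqF.
have h2 : normc (cis t - cis u) <= e / (`|K| + 1).
  by apply: le_trans h _; rewrite [leRHS]splitr lerD.
apply: (@le_trans _ _ ((`|K| + 1) * normc (cis t - cis u))).
  by rewrite ler_wpM2r ?normc_ge0// (le_trans (ler_norm K))// lerDl.
by rewrite ler_wpM2l// ltW.
Unshelve. all: by end_near. Qed.

Lemma continuous_powR f r : 0 < r -> continuous f -> (forall t, 0 <= f t) ->
  continuous (fun t => f t `^ r).
Proof.
move=> r0 cf f0 t; have := f0 t; rewrite le_eqVlt => /predU1P[ft|ft]; last first.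
  apply: (@continuous_comp _ _ _ f (fun x => x `^ r)); first exact: cf.
  exact: is_derive_continuous (is_derive1_powR r ft).
rewrite /continuous_at -ft powR0 ?gt_eqF//.
apply/cvgr0Pnorm_le => e e0.
have e1 : 0 < e `^ r^-1 by exact: powR_gt0.
have := cf t; rewrite /continuous_at -ft => /cvgr0Pnorm_le /(_ _ e1).
apply: filterS => u; rewrite !ger0_norm ?powR_ge0// => hu.
have := ge0_ler_powR (ltW r0) (_ : f u \in Num.nneg) (_ : e `^ r^-1 \in Num.nneg) hu.
by rewrite !nnegrE f0 powR_ge0 -powRrM mulVf ?gt_eqF// powRr1 ?(ltW e0)//; exact.
Qed.

Lemma ln_lipschitz (a b eps : R) : 0 < eps -> eps <= a -> eps <= b ->
  `|ln a - ln b| <= eps^-1 * `|a - b|.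
Proof.
move=> e0; wlog ab : a b / b <= a => [H ea eb|].
  by have [/H|/ltW/H] := leP b a; [exact|rewrite distrC [`|a - b|]distrC; exact].
move=> ea eb; have b0 : 0 < b by exact: lt_le_trans eb.
have a0 : 0 < a by exact: lt_le_trans ea.
rewrite !ger0_norm ?subr_ge0 ?ler_ln ?posrE//.
rewrite -ln_div ?posrE//.
apply: (@le_trans _ _ (a / b - 1)).
  by have := @le_ln1Dx R (a / b - 1); rewrite subrKC ltrBrDl subrr divr_gt0//; exact.
have -> : a / b - 1 = b^-1 * (a - b) by field; rewrite gt_eqF.
by rewrite ler_wpM2r ?subr_ge0// lef_pV2 ?posrE.
Qed.

Lemma max_lipschitz (a b eps : R) : `|Num.max a eps - Num.max b eps| <= `|a - b|.
Proof.
wlog ab : a b / b <= a => [H|].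
  by have [/H|/ltW/H] := leP b a; [exact|rewrite distrC [`|a - b|]distrC; exact].
rewrite [leRHS]ger0_norm ?subr_ge0//.
by rewrite ler_norml; have [] := leP a eps; have [] := leP b eps => *; apply/andP; split; lra.
Qed.

Section vector.
Context {X : normedModType R[i]} {A : finType}.
Implicit Types (e : A -> nat) (y : A -> X).

Lemma rnorm_vpoly_lipschitz e y : exists2 K, 0 <= K & forall rho, 0 <= rho <= 1 ->
  forall t u, `|rnorm (vpoly e y (rho%:C * cis t)) - rnorm (vpoly e y (rho%:C * cis u))|
    <= K * normc (cis t - cis u).
Proof.
have [K K0 hK] := vpoly_lipschitz e y 1; exists K => // rho /andP[rho0 rho1] t u.
have n1 v : normc (rho%:C * cis v) <= 1 by rewrite Normc.normcM normcC normc_cis mulr1 ger0_norm.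
rewrite (le_trans (rnorm_dist _ _))//.
have [_ h] := hK _ _ (n1 t) (n1 u); apply: le_trans h _.
rewrite ler_wpM2l// -mulrBr Normc.normcM normcC ger0_norm//.
by rewrite -[leRHS]mul1r ler_wpM2r// normc_ge0.
Qed.

Lemma continuous_rnorm_vpoly e y rho : 0 <= rho <= 1 ->
  continuous (fun t => rnorm (vpoly e y (rho%:C * cis t))).
Proof.
move=> hrho; have [K _ /(_ rho hrho) hK] := rnorm_vpoly_lipschitz e y.
exact: lipschitz_continuous hK.
Qed.

(* The norm on the circle, truncated below by [eps], is replaced by [expR u] with
   [u] a trigonometric polynomial; the majorant survives dilation by
   [exp_majorant]. *)
Lemma vector_hypercontractivity e y s r : 0 < s -> s <= r ->
  circle_mean (fun t => rnorm (vpoly e y ((Num.sqrt (s / r))%:C * cis t)) `^ r) <=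
  circle_mean (fun t => rnorm (vpoly e y (cis t)) `^ s) `^ (r / s).
Proof.
move=> s0 sr; have r0 : 0 < r by exact: lt_le_trans sr.
set rho := Num.sqrt (s / r).
have hrho : 0 <= rho <= 1.
  by rewrite sqrtr_ge0 -sqrtr1 ler_wsqrtr// ler_pdivrMr// mul1r.
have h1 : 0 <= (1 : R) <= 1 by rewrite ler01 lexx.
(* The limit eps -> 0 is taken in the form b^(s/r) <= a, whose perturbed right-hand side is affine
   in a; the power changes sides only at the end. *)
have powR_swap (p q : R) : 0 <= p -> 0 <= q -> q `^ (s / r) <= p -> q <= p `^ (r / s).
  move=> p0 q0 qp; have rs0 : 0 <= r / s by rewrite divr_ge0 ?ltW.
  have := ge0_ler_powR rs0 _ _ qp; rewrite !nnegrE => /(_ (powR_ge0 _ _) p0).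
  rewrite -powRrM.
  have -> : s / r * (r / s) = 1 by field; rewrite !gt_eqF.
  by rewrite powRr1.
pose f t := rnorm (vpoly e y (cis t)).
have f1 : f = fun t => rnorm (vpoly e y (1%:C * cis t)).
  by apply/funext => t; rewrite /f mul1r.
have cf : continuous f by rewrite f1; exact: continuous_rnorm_vpoly.
have f0 t : 0 <= f t by exact: rnorm_ge0.
have [K K0 /(_ 1 h1) hK] := rnorm_vpoly_lipschitz e y.
have fL t u : `|f t - f u| <= K * normc (cis t - cis u).
  by have := hK t u; rewrite !mul1r.
pose a := circle_mean (fun t => f t `^ s).
pose b := circle_mean (fun t => rnorm (vpoly e y (rho%:C * cis t)) `^ r).
have cfs := continuous_powR s0 cf f0.
have cfr : continuous (fun t => rnorm (vpoly e y (rho%:C * cis t)) `^ r).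
  by apply: (continuous_powR r0 (@continuous_rnorm_vpoly e y rho hrho)) => t; exact: rnorm_ge0.
have a0 : 0 <= a by apply: (circle_mean_ge cfs) => t; exact: powR_ge0.
have b0 : 0 <= b by apply: (circle_mean_ge cfr) => t; exact: powR_ge0.
change (b <= a `^ (r / s)).
have fE t : rnorm (vpoly e y (cis t)) = f t by [].
clearbody f.
have key eps : 0 < eps -> b `^ (s / r) <= expR (s * (2 * eps)) * (a + eps `^ s).
  move=> e0; pose v t := ln (Num.max (f t) eps).
  have me t : eps <= Num.max (f t) eps by rewrite le_max lexx orbT.
  have m0 t : 0 < Num.max (f t) eps by exact: lt_le_trans (me t).
  have vL t u : `|v t - v u| <= eps^-1 * K * normc (cis t - cis u).
    apply: le_trans (ln_lipschitz e0 (me t) (me u)) _.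
    rewrite -mulrA ler_pM2l ?invr_gt0//.
    by apply: le_trans (max_lipschitz _ _ _) _.
  have K'0 : 0 <= eps^-1 * K by rewrite mulr_ge0// invr_ge0 ltW.
  have vE t : expR (v t) = Num.max (f t) eps by rewrite lnK// posrE.
  have vsE t : expR (s * v t) = Num.max (f t) eps `^ s by rewrite /powR gt_eqF.
  clearbody v.
  (* Approximating v + eps within eps gives the one-sided bounds v <= Re g <= v + 2 eps. *)
  have vL' t u : `|(v t + eps) - (v u + eps)| <= eps^-1 * K * normc (cis t - cis u).
    by rewrite opprD addrACA subrr addr0.
  have [g hg] := weierstrass K'0 e0 vL'.
  have gv t : v t <= Re g.[cis t] <= v t + 2 * eps.
    by have := hg t; rewrite ler_norml => /andP[h2 h3]; apply/andP; split; lra.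
  have fg t : f t <= expR (Re g.[cis t]).
    apply: (@le_trans _ _ (Num.max (f t) eps)); first by rewrite le_max lexx.
    by rewrite -vE ler_expR; case/andP: (gv t).
  have frg t : rnorm (vpoly e y (rho%:C * cis t)) <= expR (Re g.[rho%:C * cis t]).
    by apply: exp_majorant => // u; rewrite fE.
  have cg := @continuous_Re_cis _ g.
  have cgr := @continuous_Re_horner _ g rho.
  have B : b <= circle_mean (fun t => expR (r * Re g.[rho%:C * cis t])).
    have cer := continuous_exp (@continuous_scale _ r _ cgr).
    apply: (circle_mean_le cfr cer) => t.
    have := ge0_ler_powR (ltW r0) _ _ (frg t); rewrite !nnegrE rnorm_ge0 expR_ge0.
    by move=> /(_ isT isT); rewrite [X in _ <= X -> _]/powR gt_eqF ?expR_gt0// expRK.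
  have {}B := le_trans B (scalar_hypercontractivity g s0 sr).
  set Z := circle_mean (fun t => expR (s * _)) in B.
  have ZA : Z <= expR (s * (2 * eps)) * (a + eps `^ s).
    have cc : continuous (fun _ : R => eps `^ s) by move=> t; exact: cvg_cst.
    have cfc : continuous (fun t => f t `^ s + eps `^ s).
      by move=> t; apply: cvgD; [exact: cfs|exact: cc].
    have -> : a + eps `^ s = circle_mean (fun t => f t `^ s + eps `^ s).
      by rewrite (circle_meanD cfs cc) circle_mean_cst.
    rewrite -(circle_meanZ _ cfc).
    have ceg := continuous_exp (@continuous_scale _ s _ cg).
    apply: (circle_mean_le ceg (@continuous_scale _ _ _ cfc)) => t.
    apply: (@le_trans _ _ (expR (s * (v t + 2 * eps)))).
      by rewrite ler_expR ler_pM2l//; case/andP: (gv t).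
    rewrite mulrDr expRD mulrC ler_wpM2l ?expR_ge0//.
    rewrite vsE.
    by have [_|_] := leP (f t) eps; rewrite ?lerDl ?lerDr powR_ge0.
  apply: le_trans ZA.
  have sr0 : 0 <= s / r by rewrite divr_ge0 ?ltW.
  have Z0 : 0 <= Z.
    apply: (circle_mean_ge (continuous_exp (@continuous_scale _ s _ cg))) => t.
    exact: expR_ge0.
  have := ge0_ler_powR sr0 _ _ B; rewrite !nnegrE => /(_ b0 (powR_ge0 _ _)).
  rewrite -powRrM.
  have -> : r / s * (s / r) = 1 by field; rewrite !gt_eqF.
  by rewrite powRr1.
have ba : b `^ (s / r) <= a.
  have lim : expR (s * (2 * eps)) * (a + eps `^ s) @[eps --> 0^'+] --> expR (s * (2 * 0)) * (a + 0).
    apply: cvgM; last by apply: cvgD; [exact: cvg_cst|exact: powR_cvg0].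
    apply: cvg_at_right_filter.
    have := @continuous_exp _ (fun eps => s * (2 * eps)); apply.
    by apply: continuous_scale; apply: continuous_scale => x; exact: cvg_id.
  rewrite !mulr0 expR0 mul1r addr0 in lim.
  apply: (cvgr_to_ge lim); near=> eps; apply: key.
  by near: eps; exact: nbhs_right_gt.
exact: powR_swap.
Unshelve. all: by end_near. Qed.

End vector.
End vector_hypercontractivity.

(** * Several variables *)

Section minkowski_integral.
Context d1 d2 (T1 : measurableType d1) (T2 : measurableType d2) (R : realType).
Local Open Scope ereal_scope.

(** With a(y) the inner mean, I = int a^q equals the double integral of a(y)^(q-1) h(x, y). Hölder
    in y bounds it by I^(1/p) times the right-hand side, and I^(1/p) is divided out; the bound [M]
    makes I finite, as this division requires. *)
Lemma minkowski_integral (mu : probability T1 R) (nu : probability T2 R)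
    (h : T1 * T2 -> R) (M q : R) : (1 <= q)%R ->
  measurable_fun setT h -> (forall z, 0 <= h z <= M)%R ->
  (\int[nu]_y ((\int[mu]_x (h (x, y))%:E) `^ q)) `^ q^-1 <=
  \int[mu]_x ((\int[nu]_y (h (x, y) `^ q)%:E) `^ q^-1).
Proof.
move=> q1 mh hM.
have q0 : (0 < q)%R by exact: lt_le_trans q1.
have h0 z : (0 <= h z)%R by case/andP: (hM z).
pose eh : T1 * T2 -> \bar R := EFin \o h.
have mEh : measurable_fun setT eh by exact/measurable_EFinP.
have eh0 z : 0 <= eh z by rewrite lee_fin.
pose A y := \int[mu]_x (h (x, y))%:E.
have mA : measurable_fun setT A by exact: (measurable_fun_fubini_tonelli_G (m1 := mu) eh mEh eh0).
have A0 y : 0 <= A y by apply: integral_ge0 => x _; rewrite lee_fin.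
have AM y : A y <= M%:E.
  rewrite -[leRHS]mule1 -(@probability_setT _ _ _ mu) -integral_cst//.
  apply: ge0_le_integral => //.
  - by move=> x _; rewrite lee_fin.
  - exact: measurableT_comp mEh (measurable_pair2 y).
  - by move=> x _; rewrite lee_fin; case/andP: (hM (x, y)).
have Af y : A y \is a fin_num.
  by rewrite ge0_fin_numE// (le_lt_trans (AM y))// ltry.
pose a y := fine (A y).
have aE y : (a y)%:E = A y by rewrite fineK.
have a0 y : (0 <= a y)%R by exact: fine_ge0.
have ma : measurable_fun setT a by exact: measurableT_comp.
rewrite -/(fun y => A y).
pose I := \int[nu]_y (a y `^ q)%:E.
have -> : \int[nu]_y (A y `^ q) = I by apply: eq_integral => y _; rewrite -aE.
(* For q = 1 the conjugate exponent is infinite; the claim is then Tonelli's theorem. *)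
move: q1; rewrite le_eqVlt => /predU1P[q1|q1].
  rewrite /I -q1 invr1 poweRe1; last by apply: integral_ge0 => y _; rewrite lee_fin powR_ge0.
  under eq_integral do rewrite powRr1// aE.
  rewrite -(fubini_tonelli (m1 := mu) (m2 := nu) eh mEh eh0) le_eqVlt; apply/orP; left; apply/eqP.
  apply: eq_integral => x _; rewrite poweRe1.
    by apply: eq_integral => y _; rewrite powRr1.
  by apply: integral_ge0 => y _; rewrite lee_fin powR_ge0.
pose p := (q / (q - 1))%R.
have qn1 : (0 < q - 1)%R by rewrite subr_gt0.
have p0 : (0 < p)%R by rewrite divr_gt0.
have pq : (p^-1 + q^-1 = 1)%R by rewrite /p; field; rewrite !gt_eqF.
have pE : ((q - 1) * p = q)%R by rewrite /p; field; rewrite gt_eqF.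
pose b y := (a y `^ (q - 1))%R.
have mb : measurable_fun setT b by exact: measurableT_comp (measurable_powR _) ma.
have b0 y : (0 <= b y)%R by exact: powR_ge0.
have aqE y : (a y `^ q)%:E = (b y)%:E * A y.
  rewrite -aE -EFinM; congr EFin; rewrite /b.
  have := a0 y; rewrite le_eqVlt => /predU1P[<-|ay]; first by rewrite powR0 ?mulr0 ?gt_eqF.
  rewrite -[X in (_ = _ * X)%R]powRr1 ?(ltW ay)// -powRD ?subrK//.
  by rewrite (gt_eqF ay) implybT.
pose k (z : T1 * T2) := (b z.2 * h z)%R.
pose ek : T1 * T2 -> \bar R := EFin \o k.
have mek : measurable_fun setT ek.
  apply/measurable_EFinP; apply: measurable_funM => //.
  exact: measurableT_comp mb measurable_snd.
have ek0 z : 0 <= ek z by rewrite lee_fin mulr_ge0.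
have mh2 x : measurable_fun setT (fun y => h (x, y)).
  exact: measurableT_comp mh (measurable_pair1 x).
have I0 : 0 <= I by apply: integral_ge0 => y _; rewrite lee_fin powR_ge0.
have IE : I = \int[mu]_x \int[nu]_y (k (x, y))%:E.
  rewrite (fubini_tonelli (m1 := mu) (m2 := nu) ek mek ek0); apply: eq_integral => y _.
  rewrite aqE -ge0_integralZl_EFin//.
  - by move=> x _; rewrite lee_fin.
  - apply/measurable_EFinP; exact: measurableT_comp mh (measurable_pair2 y).
pose C := \int[mu]_x ((\int[nu]_y (h (x, y) `^ q)%:E) `^ q^-1).
rewrite -/C.
have hold x : \int[nu]_y (k (x, y))%:E <=
    I `^ p^-1 * (\int[nu]_y (h (x, y) `^ q)%:E) `^ q^-1.
  have := @hoelder _ _ _ nu b (fun y => h (x, y)) p q mb (mh2 x) p0 q0 pq.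
  rewrite Lnorm1 unlock /=.
  under eq_integral do rewrite ger0_norm ?mulr_ge0//.
  rewrite [X in _ <= X `^ _ * _ -> _](eq_integral (fun y => (a y `^ q)%:E)); last first.
    by move=> y _; rewrite ger0_norm// -powRrM pE.
  rewrite [X in _ <= _ * X `^ _ -> _](eq_integral (fun y => (h (x, y) `^ q)%:E)); last first.
    by move=> y _; rewrite ger0_norm.
  exact.
have IM : I <= (M `^ q)%:E.
  have M0 : (0 <= M)%R by case/andP: (hM (point, point)) => /le_trans; apply.
  rewrite -[leRHS]mule1 -(@probability_setT _ _ _ nu) -(integral_cst nu measurableT).
  apply: ge0_le_integral => //.
  - by move=> y _; rewrite lee_fin powR_ge0.
  - apply/measurable_EFinP; exact: measurableT_comp (measurable_powR _) ma.
  - move=> y _; rewrite lee_fin ge0_ler_powR ?nnegrE ?(ltW q0)//.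
    by rewrite -lee_fin aE.
have If : I \is a fin_num by rewrite ge0_fin_numE// (le_lt_trans IM)// ltry.
have C0 : 0 <= C by apply: integral_ge0 => x _; exact: poweR_ge0.
pose ehq (z : T1 * T2) := (h z `^ q)%:E.
have mehq : measurable_fun setT ehq.
  by apply/measurable_EFinP; exact: measurableT_comp (measurable_powR _) mh.
have ehq0 z : 0 <= ehq z by rewrite lee_fin powR_ge0.
have mc : measurable_fun setT (fun x => (\int[nu]_y (h (x, y) `^ q)%:E) `^ q^-1).
  apply: measurableT_comp (measurable_poweR _) _.
  exact: (measurable_fun_fubini_tonelli_F (m2 := nu) ehq mehq ehq0).
have IC : I <= I `^ p^-1 * C.
  rewrite {1}IE -ge0_integralZl//; last 2 first.
  - by move=> x _; exact: poweR_ge0.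
  - exact: poweR_ge0.
  apply: ge0_le_integral => //.
  - by move=> x _; apply: integral_ge0 => y _; exact: (ek0 (x, y)).
  - exact: (measurable_fun_fubini_tonelli_F (m2 := nu) ek mek ek0).
  - exact: measurable_funeM.
have [->|In0] := eqVneq I 0; first by rewrite poweR0r ?invr_eq0 ?gt_eqF.
have i0 : (0 < fine I)%R by rewrite fine_gt0// lt0e In0 I0 -ge0_fin_numE.
have [Cf|] := boolP (C \is a fin_num); last first.
  by rewrite ge0_fin_numE// -leNgt leye_eq => /eqP ->; rewrite leey.
move: IC; rewrite -(fineK If) -(fineK Cf) !poweR_EFin -EFinM !lee_fin.
rewrite -ler_pdivrMl ?powR_gt0//; apply: le_trans.
rewrite le_eqVlt; apply/orP; left; apply/eqP.
rewrite -powRN -[X in (_ = _ * X)%R]powRr1 ?ltW// -powRD ?(gt_eqF i0) ?implybT//.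
by congr powR; rewrite -pq; ring.
Qed.
End minkowski_integral.

(** * Measurability and integration on the circle *)

Section circle_integral.
Context {R : realType}.
Implicit Types (z : circle R).

Lemma continuous_circle_val : continuous (@circle_val R : circle R -> R[i]^o).
Proof. exact: initial_continuous. Qed.

Lemma complex_dist_Re (w z : R[i]^o) (e : R) : `|w - z| < e%:C -> `|Re w - Re z| < e.
Proof.
by rewrite -ReB normc_normr ltcR; apply: le_lt_trans; exact: le_Re_normc.
Qed.

Lemma continuous_Re : continuous (fun w : R[i]^o => Re w).
Proof.
move=> w; have F : ProperFilter (nbhs (w : R[i]^o)) by exact: nbhs_pfilter.
apply/(@cvgrPdist_lt _ _ _ (nbhs w) F) => e e0.
have e0' : (0 : R[i]) < e%:C by rewrite ltcR.
have h : nbhs w (ball w e%:C) by exact: nbhsx_ballx.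
by apply: filterS h => z; rewrite -ball_normE; exact: complex_dist_Re.
Qed.

Lemma continuous_Im : continuous (fun w : R[i]^o => Im w).
Proof.
move=> w; have F : ProperFilter (nbhs (w : R[i]^o)) by exact: nbhs_pfilter.
apply/(@cvgrPdist_lt _ _ _ (nbhs w) F) => e e0.
have e0' : (0 : R[i]) < e%:C by rewrite ltcR.
have h : nbhs w (ball w e%:C) by exact: nbhsx_ballx.
apply: filterS h => z; rewrite -ball_normE /= normc_normr ltcR; apply: le_lt_trans.
rewrite -ImN -ImD normc_sqrt -sqrtr_sqr ler_wsqrtr// lerDr sqr_ge0//.
Qed.

Lemma continuous_measurable_circle (f : circle R -> R) :
  continuous f -> measurable_fun setT f.
Proof.
move=> /continuousP cf.
apply: (measurability _ (RGenOpens.measurableE R)) => _ [_ [a [b ->]] <-].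
rewrite setTI; apply: sub_sigma_algebra; apply: cf; exact: interval_open.
Qed.

Lemma measurable_Re_circle : measurable_fun setT (fun z => Re (circle_val z)).
Proof.
apply: continuous_measurable_circle => z.
exact: (@continuous_comp _ _ _ (@circle_val R : circle R -> R[i]^o)
  (fun w : R[i]^o => Re w) z (@continuous_circle_val z) (@continuous_Re _)).
Qed.

Lemma measurable_Im_circle : measurable_fun setT (fun z => Im (circle_val z)).
Proof.
apply: continuous_measurable_circle => z.
exact: (@continuous_comp _ _ _ (@circle_val R : circle R -> R[i]^o)
  (fun w : R[i]^o => Im w) z (@continuous_circle_val z) (@continuous_Im _)).
Qed.

Lemma measurable_tpoisson_circle (rho : R) L (c : R[i]) :
  measurable_fun setT (fun z => tpoisson rho L (circle_val z * c)).
Proof.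
have mX l : measurable_fun setT (fun z => Re ((rho%:C * (circle_val z * c)) ^+ l)) /\
    measurable_fun setT (fun z => Im ((rho%:C * (circle_val z * c)) ^+ l)).
  have m1 : measurable_fun setT (fun z => Re (rho%:C * (circle_val z * c))).
    under eq_fun do rewrite ReZ ReM.
    apply: measurable_funM => //; apply: measurable_funB; apply: measurable_funM => //.
      exact: measurable_Re_circle.
    exact: measurable_Im_circle.
  have m2 : measurable_fun setT (fun z => Im (rho%:C * (circle_val z * c))).
    under eq_fun do rewrite ImM mul0r addr0 ImM /=.
    apply: measurable_funM => //; apply: measurable_funD; apply: measurable_funM => //.
      exact: measurable_Re_circle.
    exact: measurable_Im_circle.
  elim: l => [|l [IH1 IH2]]; first by split; (under eq_fun do rewrite expr0); exact: measurable_cst.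
  split.
    under eq_fun do rewrite exprS ReM.
    by apply: measurable_funB; apply: measurable_funM.
  under eq_fun do rewrite exprS ImM.
  by apply: measurable_funD; apply: measurable_funM.
apply: measurable_funB => //; apply: measurable_funM => //.
under eq_fun do rewrite Re_sum.
by apply: measurable_sum => l; exact: (mX l).1.
Qed.

Lemma circle_expi z : exists t : R, z = expi t.
Proof.
have : `|circle_val z| == 1 by case: z.
rewrite normc_normr => /eqP [nz].
have := normc_sqr (circle_val z); rewrite nz expr1n => /esym ab1.
set a := Re _ in ab1; set b := Im _ in ab1.
have a1 : -1 <= a <= 1.
  by rewrite -ler_norml -(@ler_pXn2r _ 2)// ?nnegrE// real_normK ?num_real// expr1n -ab1 lerDl sqr_ge0.
have ca : cos (acos a) = a by exact: acosK.
have sa : sin (acos a) = `|b|.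
  by rewrite sin_acos// -ab1 addrAC subrr add0r sqrtr_sqr.
exists (if 0 <= b then acos a else - acos a); apply/val_inj => /=.
apply/eqP; rewrite eq_complex /= -/a -/b.
case: (lerP 0 b) => b0; first by rewrite ca sa ger0_norm// !eqxx.
by rewrite cosN sinN ca sa ltr0_norm// opprK !eqxx.
Qed.

Lemma integral_circle (f : circle R -> R) : measurable_fun setT f ->
  (forall z, 0 <= f z) -> continuous (fun t : R => f (expi t)) ->
  (\int[circle_prob R]_z (f z)%:E = (circle_mean (fun t => f (expi t)))%:E)%E.
Proof.
move=> mf f0 cf.
have mEf : measurable_fun setT (EFin \o f) by exact/measurable_EFinP.
rewrite /circle_prob ge0_integral_distribution//.
rewrite integral_uniform; last 2 first.
- by apply/measurable_EFinP; exact: continuous_measurable_fun cf.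
- by move=> t; rewrite lee_fin.
rewrite subr0 /circle_mean EFinM; congr (_ * _)%E.
rewrite /Rintegral fineK//; apply: integrable_fin_num => //.
exact: (@continuous_integrable R (fun t => f (expi t)) 0 (pi *+ 2) cf).
Qed.

End circle_integral.

Section several_variables.
Context {R : realType} {X : normedModType R[i]} {A : finType}.
Implicit Types (y : A -> X) (s r : R).
Notation T := (circle R).
Notation P := (circle_prob R).

(** Exponents are indexed by all of [nat], so that removing the first variable is a shift of [e]
    without change of type. *)
Definition mon N (e : nat -> nat) (z : N.-tuple T) : R[i] :=
  \prod_(i < N) circle_val (tnth z i) ^+ e i.

Definition mpoly N (e : A -> nat -> nat) y (z : N.-tuple T) : X :=
  \sum_a mon (e a) z *: y a.

Lemma mon_cons N (e : nat -> nat) (u : T * N.-tuple T) :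
  mon e (tuple_cons u) = circle_val u.1 ^+ e 0%N * mon (fun i => e i.+1) u.2.
Proof.
rewrite /mon big_ord_recl tnth0; congr (_ * _).
by apply: eq_bigr => i _; rewrite tnthS.
Qed.

Lemma normc_circle (z : T) : normc (circle_val z) = 1.
Proof. by case: z => w /=; rewrite normc_normr => /eqP []. Qed.

Lemma normc_mon N (e : nat -> nat) (z : N.-tuple T) : normc (mon e z) = 1.
Proof.
rewrite /mon; elim/big_rec: _ => [|i w _ IH]; first exact: Normc.normc1.
by rewrite Normc.normcM normcX normc_circle expr1n mul1r.
Qed.

(** Here the first variable is absorbed into the coefficients, as the induction hypothesis needs;
    [mpoly_consr] absorbs the others instead, as the one-variable inequality needs. *)
Lemma mpoly_consl N e y (u : T * N.-tuple T) : mpoly e y (tuple_cons u) =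
  mpoly (fun a i => e a i.+1) (fun a => circle_val u.1 ^+ e a 0%N *: y a) u.2.
Proof. by apply: eq_bigr => a _; rewrite mon_cons scalerA mulrC. Qed.

Lemma mpoly_consr N e y (u : T * N.-tuple T) : mpoly e y (tuple_cons u) =
  vpoly (fun a => e a 0%N) (fun a => mon (fun i => e a i.+1) u.2 *: y a)
    (circle_val u.1).
Proof. by apply: eq_bigr => a _; rewrite mon_cons scalerA. Qed.

Lemma rnorm_mpoly_le N e y (z : N.-tuple T) : rnorm (mpoly e y z) <= \sum_a rnorm (y a).
Proof.
rewrite (le_trans (rnorm_sum _))// ler_sum// => a _.
by rewrite rnormZ normc_mon mul1r.
Qed.

Lemma tuple_cons_thead N (z : N.+1.-tuple T) :
  z = tuple_cons (thead z, [tuple of behead z]).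
Proof. exact: tuple_eta. Qed.

Lemma continuous_rnorm_vpoly_cis (e : A -> nat) y :
  continuous (fun t : R => rnorm (vpoly e y (cis t))).
Proof.
have h1 : 0 <= (1 : R) <= 1 by rewrite ler01 lexx.
have -> : (fun t : R => rnorm (vpoly e y (cis t))) =
    (fun t => rnorm (vpoly e y (1%:C * cis t))) by apply/funext => t; rewrite mul1r.
exact: continuous_rnorm_vpoly.
Qed.

(* Continuity in the first variable and measurability in the others: the
   function is a pointwise limit of its kernel means in the first variable,
   which are finite sums of products. *)
Lemma measurable_rnorm_mpoly_cons N e y :
  (forall e' y', measurable_fun setT (fun z : N.-tuple T => rnorm (mpoly e' y' z))) ->
  measurable_fun setT (fun u : T * N.-tuple T => rnorm (mpoly e y (tuple_cons u))).
Proof.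
move=> IH.
pose G (u : T * N.-tuple T) := rnorm (mpoly e y (tuple_cons u)).
have [K KP] : exists K : nat -> R * nat * nat, forall n (F : R -> R),
    (forall t u, `|F t - F u| <= n%:R * normc (cis t - cis u)) ->
    forall t, `|tpoisson_conv (K n).1.1 (K n).1.2 (K n).2 F t - F t| <= n.+1%:R^-1.
  have h n : exists k : R * nat * nat, forall (F : R -> R),
      (forall t u, `|F t - F u| <= n%:R * normc (cis t - cis u)) ->
      forall t, `|tpoisson_conv k.1.1 k.1.2 k.2 F t - F t| <= n.+1%:R^-1.
    have n0 : 0 < n.+1%:R^-1 :> R by rewrite invr_gt0.
    have [rho [L [k H]]] := tpoisson_conv_approx (ler0n R n) n0.
    by exists (rho, L, k).
  exists (fun n => projT1 (cid (h n))) => n; exact: (projT2 (cid (h n))).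
pose Gn n (u : T * N.-tuple T) : R := (K n).2%:R^-1 * \sum_(k < (K n).2)
  G (expi (- unity_arg (K n).2 k), u.2) *
  tpoisson (K n).1.1 (K n).1.2 (circle_val u.1 * cis (unity_arg (K n).2 k)).
apply: (@measurable_fun_cvg _ _ _ _ Gn) => [n|[z1 z'] _].
  apply: measurable_funM => //; apply: measurable_sum => k; apply: measurable_funM.
    rewrite [X in measurable_fun _ X](_ : _ = (fun z => rnorm (mpoly (fun a i => e a i.+1)
      (fun a => cis (- unity_arg (K n).2 k) ^+ e a 0%N *: y a) z)) \o snd).
      exact: measurableT_comp (IH _ _) measurable_snd.
    by apply/funext => u; rewrite /G mpoly_consl.
  exact: measurableT_comp (measurable_tpoisson_circle _ _ _) measurable_fst.
have [t ->] := circle_expi z1.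
pose F (v : R) := G (expi v, z').
have FE v : F v = rnorm (vpoly (fun a => e a 0%N)
    (fun a => mon (fun i => e a i.+1) z' *: y a) (cis v)) by rewrite /F /G mpoly_consr.
have [C C0 hC] := rnorm_vpoly_lipschitz (fun a => e a 0%N)
  (fun a => mon (fun i => e a i.+1) z' *: y a).
have h1 : 0 <= (1 : R) <= 1 by rewrite ler01 lexx.
have FL v w : `|F v - F w| <= C * normc (cis v - cis w).
  by have := hC 1 h1 v w; rewrite !mul1r !FE.
have GnE n : Gn n (expi t, z') = tpoisson_conv (K n).1.1 (K n).1.2 (K n).2 F t.
  rewrite /Gn /tpoisson_conv; congr (_ * _); apply: eq_bigr => k _ /=.
  by rewrite -cisD.
apply/cvgrPdist_le => eps eps0; near=> n.
rewrite distrC GnE -/(F t); apply: le_trans (KP n F _ t) _.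
  move=> v w; apply: le_trans (FL v w) _; rewrite ler_wpM2r ?normc_ge0//.
  near: n; exact: nbhs_infty_ger.
near: n; have := near_infty_natSinv_lt (PosNum eps0).
by apply: filterS => n /ltW.
Unshelve. all: by end_near. Qed.

Lemma measurable_rnorm_mpoly N e y :
  measurable_fun setT (fun z : N.-tuple T => rnorm (mpoly e y z)).
Proof.
elim: N e y => [|N IH] e y.
  have -> : (fun z : 0.-tuple T => rnorm (mpoly e y z)) = cst (rnorm (mpoly e y [tuple])).
    by apply/funext => z; rewrite (tuple0 z).
  exact: measurable_cst.
have -> : (fun z : N.+1.-tuple T => rnorm (mpoly e y z)) =
    (fun u : T * N.-tuple T => rnorm (mpoly e y (tuple_cons u))) \o
    (fun z : N.+1.-tuple T => (thead z, [tuple of behead z])).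
  by apply/funext => z /=; rewrite -tuple_cons_thead.
apply: measurableT_comp; first exact: measurable_rnorm_mpoly_cons.
apply: measurable_fun_pair; first exact: measurable_tnth.
exact: measurable_behead.
Qed.

End several_variables.

Section induction_on_variables.
Context {R : realType} {X : normedModType R[i]} {A : finType}.
Implicit Types (y : A -> X) (s r : R).
Notation T := (circle R).
Notation P := (circle_prob R).

Lemma measurable_rnorm_vpoly (e : A -> nat) y :
  measurable_fun setT (fun z : T => rnorm (vpoly e y (circle_val z))).
Proof.
rewrite [X in measurable_fun _ X](_ : _ = (fun u : T * 0.-tuple T =>
    rnorm (mpoly (fun a i => e a) y (tuple_cons u))) \o (fun z => (z, [tuple]))).
  apply: measurableT_comp; last exact: measurable_fun_pair.
  by apply: measurable_rnorm_mpoly_cons => e' y'; exact: measurable_rnorm_mpoly.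
apply/funext => z /=; rewrite mpoly_consr; congr rnorm; apply: eq_bigr => a _.
by rewrite /mon big_ord0 scale1r.
Qed.

Lemma circle_hypercontractivity (e : A -> nat) y s r : 0 < s -> s <= r ->
  (\int[P]_z (rnorm (vpoly e (fun a => (Num.sqrt (s / r))%:C ^+ e a *: y a)
      (circle_val z)) `^ r)%:E <=
   (\int[P]_z (rnorm (vpoly e y (circle_val z)) `^ s)%:E) `^ (r / s))%E.
Proof.
move=> s0 sr; have r0 : 0 < r by exact: lt_le_trans sr.
set rho := Num.sqrt (s / r).
have E w : vpoly e (fun a => rho%:C ^+ e a *: y a) w = vpoly e y (rho%:C * w).
  by apply: eq_bigr => a _; rewrite scalerA exprMn mulrC.
have mP p y' : measurable_fun setT (fun z : T => rnorm (vpoly e y' (circle_val z)) `^ p).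
  by apply: measurableT_comp (measurable_powR _) _; exact: measurable_rnorm_vpoly.
have cP p y' : 0 < p -> continuous (fun t : R => rnorm (vpoly e y' (circle_val (expi t))) `^ p).
  move=> p0; apply: continuous_powR => //; last by move=> t; exact: rnorm_ge0.
  exact: continuous_rnorm_vpoly_cis.
rewrite !integral_circle//; try by move=> z; exact: powR_ge0.
- rewrite poweR_EFin lee_fin.
  under [X in circle_mean X]eq_fun do rewrite E.
  exact: vector_hypercontractivity.
- exact: cP.
- exact: cP.
Qed.

(** The dilation is split into the first variable and the rest. The one-variable inequality treats
    the first variable for fixed others, Minkowski with exponent r/s exchanges the two integrations,
    and the induction hypothesis treats the rest for a fixed first variable. *)
Lemma mpoly_hypercontractivity N (e : A -> nat -> nat) y s r : 0 < s -> s <= r ->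
  (\int[power_prob P N]_z (rnorm (mpoly e (fun a =>
      (Num.sqrt (s / r))%:C ^+ (\sum_(i < N) e a i) *: y a) z) `^ r)%:E <=
   (\int[power_prob P N]_z (rnorm (mpoly e y z) `^ s)%:E) `^ (r / s))%E.
Proof.
move=> s0 sr; have r0 : 0 < r by exact: lt_le_trans sr.
set rho := Num.sqrt (s / r).
have q1 : 1 <= r / s by rewrite ler_pdivlMr// mul1r.
have q0 : 0 < r / s by exact: lt_le_trans q1.
elim: N e y => [|N IH] e y.
  have E p y' : (\int[power_prob P 0]_z (rnorm (mpoly e y' z) `^ p)%:E =
      (rnorm (mpoly e y' [tuple]) `^ p)%:E)%E.
    rewrite (eq_integral (fun=> (rnorm (mpoly e y' [tuple]) `^ p)%:E)); last first.
      by move=> z _; rewrite (tuple0 z).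
    rewrite integral_cst//; apply: eq_trans (mule1 _); congr (_ * _)%E.
    exact: probability_setT.
  rewrite !E poweR_EFin -powRrM.
  have -> : s * (r / s) = r by field; rewrite gt_eqF.
  have -> : (fun a => rho%:C ^+ (\sum_(i < 0) e a i) *: y a) = y.
    by apply/funext => a; rewrite big_ord0 expr0 scale1r.
  by [].
pose nu := power_prob P N.
have mP p e' y' : measurable_fun setT (fun z : N.+1.-tuple T => (rnorm (mpoly e' y' z) `^ p)%:E).
  by apply/measurable_EFinP; apply: measurableT_comp (measurable_powR _) _;
    exact: measurable_rnorm_mpoly.
have mP2 p e' y' : measurable_fun setT
    (fun u : T * N.-tuple T => (rnorm (mpoly e' y' (tuple_cons u)) `^ p)%:E).
  by exact: measurableT_comp (mP p e' y') (@measurable_tuple_cons _ _ N).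
have ge0P p n e' y' (z : n.-tuple T) : (0 <= (rnorm (mpoly e' y' z) `^ p)%:E)%E.
  by rewrite lee_fin powR_ge0.
have E p y' : (\int[power_prob P N.+1]_z (rnorm (mpoly e y' z) `^ p)%:E =
    \int[P \x nu]_u (rnorm (mpoly e y' (tuple_cons u)) `^ p)%:E)%E.
  by rewrite /= ge0_integral_distribution//; exact: mP.
rewrite !E.
(* The degree in the remaining variables: [h] has these dilated and the first variable not yet. *)
pose sg a := (\sum_(i < N) e a i.+1)%N.
pose h (u : T * N.-tuple T) :=
  rnorm (mpoly e (fun a => rho%:C ^+ sg a *: y a) (tuple_cons u)) `^ s.
pose M := (\sum_a rnorm (rho%:C ^+ sg a *: y a)) `^ s.
have mh : measurable_fun setT h.
  by apply/measurable_EFinP; exact: mP2.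
have hM u : 0 <= h u <= M.
  rewrite powR_ge0 /=; apply: ge0_ler_powR; rewrite ?nnegrE ?rnorm_ge0 ?(ltW s0)//.
    by rewrite sumr_ge0// => a _; exact: rnorm_ge0.
  exact: rnorm_mpoly_le.
have mink := @minkowski_integral _ _ _ _ R P nu h M (r / s) q1 mh hM.
apply: (@le_trans _ _ (\int[nu]_z' ((\int[P]_z (h (z, z'))%:E) `^ (r / s)))%E).
  rewrite (fubini_tonelli2 (m1 := P) (m2 := nu))//.
  apply: ge0_le_integral => //.
  - by move=> z' _; apply: integral_ge0 => z _; exact: ge0P.
  - exact: (measurable_fun_fubini_tonelli_G (m1 := P) _ (mP2 r _ _) (fun u => ge0P _ _ _ _ _)).
  - apply: measurableT_comp (measurable_poweR _) _.
    apply: (measurable_fun_fubini_tonelli_G (m1 := P) (EFin \o h)) => //.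
      exact/measurable_EFinP.
    by move=> u; rewrite lee_fin; case/andP: (hM u).
  move=> z' _.
  pose y' a := mon (fun i => e a i.+1) z' *: (rho%:C ^+ sg a *: y a).
  have E1 z : mpoly e (fun a => rho%:C ^+ (\sum_(i < N.+1) e a i) *: y a) (tuple_cons (z, z')) =
      vpoly (fun a => e a 0%N) (fun a => rho%:C ^+ e a 0%N *: y' a) (circle_val z).
    rewrite mpoly_consr; apply: eq_bigr => a _; congr (_ *: _).
    rewrite /y' big_ord_recl exprD /= !scalerA; congr (_ *: _).
    by rewrite mulrCA mulrA.
  have E2 z : h (z, z') = rnorm (vpoly (fun a => e a 0%N) y' (circle_val z)) `^ s.
    by rewrite /h mpoly_consr.
  rewrite /fubini_G (eq_integral (fun z => (rnorm (vpoly (fun a => e a 0%N)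
    (fun a => rho%:C ^+ e a 0%N *: y' a) (circle_val z)) `^ r)%:E)); last first.
    by move=> z _; rewrite E1.
  rewrite [X in (_ <= X `^ _)%E](eq_integral (fun z => (rnorm (vpoly (fun a => e a 0%N) y'
    (circle_val z)) `^ s)%:E)); last by move=> z _; rewrite E2.
  exact: circle_hypercontractivity.
have lhs0 : (0 <= \int[nu]_z' ((\int[P]_z (h (z, z'))%:E) `^ (r / s)))%E.
  by apply: integral_ge0 => z' _; exact: poweR_ge0.
have ge0in (x : \bar R) : (0 <= x)%E -> x \in `[0%E, +oo%E].
  by move=> x0; rewrite in_itv/= x0 leey.
have J0 : (0 <= \int[P]_z \int[nu]_z' (rnorm (mpoly e y (tuple_cons (z, z'))) `^ s)%:E)%E.
  by apply: integral_ge0 => z _; apply: integral_ge0 => z' _; exact: ge0P.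
rewrite (fubini_tonelli1 (m1 := P) (m2 := nu))//.
(* Exposes the root of order r/s, the form in which Minkowski's inequality is stated. *)
have -> : (\int[nu]_z' ((\int[P]_z (h (z, z'))%:E) `^ (r / s)) =
    ((\int[nu]_z' ((\int[P]_z (h (z, z'))%:E) `^ (r / s))) `^ (r / s)^-1) `^ (r / s))%E.
  by rewrite -poweRrM mulVf ?gt_eqF// poweRe1.
apply: gt0_ler_poweR; rewrite ?(ltW q0)//; try by apply: ge0in; rewrite ?poweR_ge0.
apply: le_trans mink _; apply: ge0_le_integral => //.
- by move=> z _; exact: poweR_ge0.
- apply: measurableT_comp (measurable_poweR _) _.
  apply: (measurable_fun_fubini_tonelli_F (m2 := nu) (fun u => (h u `^ (r / s))%:E)).
    by apply/measurable_EFinP; exact: measurableT_comp (measurable_powR _) mh.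
  by move=> u; rewrite lee_fin powR_ge0.
- exact: (measurable_fun_fubini_tonelli_F (m2 := nu) _ (mP2 s e y) (fun u => ge0P _ _ _ _ _)).
move=> z _; rewrite /fubini_F.
have -> : (\int[nu]_z' (rnorm (mpoly e y (tuple_cons (z, z'))) `^ s)%:E =
    ((\int[nu]_z' (rnorm (mpoly e y (tuple_cons (z, z'))) `^ s)%:E) `^ (r / s)) `^ (r / s)^-1)%E.
  rewrite -poweRrM mulfV ?gt_eqF// poweRe1//.
  by apply: integral_ge0 => z' _; exact: ge0P.
apply: gt0_ler_poweR; rewrite ?invr_ge0 ?(ltW q0)//.
- by apply: ge0in; apply: integral_ge0 => z' _; rewrite lee_fin powR_ge0.
- by apply: ge0in; exact: poweR_ge0.
pose y' a := circle_val z ^+ e a 0%N *: y a.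
have E1 z' : h (z, z') `^ (r / s) = rnorm (mpoly (fun a i => e a i.+1)
    (fun a => rho%:C ^+ sg a *: y' a) z') `^ r.
  rewrite /h -powRrM.
  have -> : s * (r / s) = r by field; rewrite gt_eqF.
  rewrite mpoly_consl; congr (rnorm _ `^ _); apply: eq_bigr => a _; congr (_ *: _).
  by rewrite /y' !scalerA mulrC.
rewrite (eq_integral (fun z' => (rnorm (mpoly (fun a i => e a i.+1)
    (fun a => rho%:C ^+ sg a *: y' a) z') `^ r)%:E)); last by move=> z' _; rewrite E1.
rewrite [X in (_ <= X `^ _)%E](eq_integral (fun z' => (rnorm (mpoly (fun a i => e a i.+1)
    y' z') `^ s)%:E)); last by move=> z' _; rewrite mpoly_consl.
exact: IH.
Qed.

End induction_on_variables.

(** * Homogeneous polynomials and the final constant *)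

Section homogeneous.
Context {R : realType} {X : normedModType R[i]} {N m : nat}.

Definition exponent (a : multiindex N m) (i : nat) : nat :=
  oapp (fun j : 'I_N => sval a j : nat) 0%N (insub i).

Lemma exponentE (a : multiindex N m) (i : 'I_N) : exponent a i = sval a i.
Proof. by rewrite /exponent valK. Qed.

Lemma homog_polyE (x : multiindex N m -> X) (z : N.-tuple (circle R)) :
  homog_poly x z = mpoly exponent x z.
Proof.
apply: eq_bigr => a _; congr (_ *: _).
by apply: eq_bigr => i _; rewrite exponentE.
Qed.

(** All monomials have total degree m, so dilating every variable multiplies the polynomial by
    rho^m, which leaves the integral as rho^m to the power r. *)
Lemma homog_poly_hypercontractivity (x : multiindex N m -> X) (s r : R) :
  0 < s -> s <= r ->
  (((Num.sqrt (s / r) ^+ m) `^ r)%:E *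
    \int[power_prob (circle_prob R) N]_z ((rnorm (homog_poly x z)) `^ r)%:E <=
   (\int[power_prob (circle_prob R) N]_z ((rnorm (homog_poly x z)) `^ s)%:E) `^ (r / s))%E.
Proof.
move=> s0 sr; have := mpoly_hypercontractivity N exponent x s0 sr.
set rho := Num.sqrt (s / r) => h.
have mP : measurable_fun setT (fun z : N.-tuple (circle R) => (rnorm (homog_poly x z) `^ r)%:E).
  apply/measurable_EFinP; apply: measurableT_comp (measurable_powR _) _.
  by under eq_fun do rewrite homog_polyE; exact: measurable_rnorm_mpoly.
rewrite -ge0_integralZl_EFin; [|exact: measurableT|by move=> z _; rewrite lee_fin powR_ge0
  |exact: mP|exact: powR_ge0].
rewrite (eq_integral (fun z => (rnorm (mpoly exponent (fun a =>
    rho%:C ^+ (\sum_(i < N) exponent a i) *: x a) z) `^ r)%:E)); last first.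
  move=> z _; rewrite -EFinM; congr EFin.
  rewrite -powRM ?rnorm_ge0 ?exprn_ge0 ?sqrtr_ge0//; congr (_ `^ _).
  have <- : normc (rho%:C ^+ m) = rho ^+ m by rewrite normcX normcC ger0_norm// sqrtr_ge0.
  rewrite -rnormZ homog_polyE scaler_sumr; congr rnorm; apply: eq_bigr => a _.
  rewrite !scalerA mulrC; congr (_ * _ ^+ _ *: _).
  by under eq_bigr do rewrite exponentE; apply/esym/eqP; exact: (valP a).
rewrite [X in (_ <= X `^ _)%E](eq_integral (fun z => (rnorm (mpoly exponent x z) `^ s)%:E))//.
by move=> z _; rewrite homog_polyE.
Qed.

End homogeneous.

Theorem proposition1p2 (R : realType) (s r : R) (hs : 1 <= s) (hsr : s <= r)
    (X : completeNormedModType R[i]) (m N : nat) (hm : (0 < m)%N)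
    (hN : (0 < N)%N) (x : multiindex N m -> X) :
  ((\int[power_prob (circle_prob R) N]_z ((rnorm (homog_poly x z)) `^ r)%:E)
      `^ r^-1
   <= ((r / s) `^ (m%:R / 2))%:E *
      (\int[power_prob (circle_prob R) N]_z ((rnorm (homog_poly x z)) `^ s)%:E)
      `^ s^-1)%E.
Proof.
have s0 : 0 < s by exact: lt_le_trans hs.
have r0 : 0 < r by exact: lt_le_trans hsr.
have := homog_poly_hypercontractivity x s0 hsr.
have I0 p : (0 <= \int[power_prob (circle_prob R) N]_z ((rnorm (homog_poly x z)) `^ p)%:E)%E.
  by apply: integral_ge0 => z _; rewrite lee_fin powR_ge0.
move: (I0 r) (I0 s); set Ir := (\int[_]_z _)%E; set Is := (\int[_]_z (_ `^ s)%:E)%E.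
move=> Ir0 Is0 h; pose c := Num.sqrt (s / r) ^+ m.
have c0 : 0 <= c by rewrite exprn_ge0// sqrtr_ge0.
(* As rho^2 = s/r, the constant of the theorem is the inverse of rho^m, so multiplying by it clears
   the left-hand side. *)
have kc : (r / s) `^ (m%:R / 2) * c = 1.
  have sr0 : 0 < s / r by rewrite divr_gt0.
  have -> : c = (s / r) `^ (m%:R / 2).
    rewrite /c -powR12_sqrt ?(ltW sr0)// -powR_mulrn ?powR_ge0// -powRrM.
    by congr powR; rewrite mulrC.
  rewrite -powRM ?(ltW sr0) ?divr_ge0 ?(ltW r0) ?(ltW s0)//.
  have -> : r / s * (s / r) = 1 by field; rewrite !gt_eqF.
  by rewrite powR1.
have ge0in (y : \bar R) : (0 <= y)%E -> y \in `[0%E, +oo%E].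
  by move=> y0; rewrite in_itv/= y0 leey.
have ri0 : 0 <= r^-1 by rewrite invr_ge0 ltW.
have := gt0_ler_poweR ri0 (ge0in _ (mule_ge0 _ Ir0)) (ge0in _ (poweR_ge0 _ _)) h.
rewrite lee_fin powR_ge0 => /(_ isT).
rewrite poweRM ?lee_fin ?powR_ge0// poweR_EFin -powRrM divff ?gt_eqF// powRr1//.
rewrite -poweRrM.
have -> : r / s * r^-1 = s^-1 by field; rewrite !gt_eqF.
move=> h2; have k0 : (0 <= ((r / s) `^ (m%:R / 2))%:E)%E by rewrite lee_fin powR_ge0.
have := lee_wpmul2l k0 h2.
by rewrite muleA -EFinM kc mul1e.
Qed.
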